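(* Let $\lambda>0$, and let $Y_r$ be the set of directions $\theta\in[0,2\pi)$ such that the geodesic segment $L_r(\theta)$ of hyperbolic length $r$ from the origin does not intersect the union $\mathcal L$ of the lines of the Poisson line process of parameter $\lambda$ in $\mathbb H^2$ (defined in the context). Then there exist constants $0<c\le c'<\infty$ and $r_0<\infty$, depending only on $\lambda$, such that for all $r\ge r_0$: (i) if $\lambda>1/2$, then $c\,e^{-(2\lambda-1)r}\le \mathbf P[Y_r\ne\emptyset]\le c'\,e^{-(2\lambda-1)r}$; (ii) if $\lambda=1/2$, then $c\,\frac1r\le \mathbf P[Y_r\ne\emptyset]\le c'\,\frac1r$.
   Context: $\mathbb H^2$ is the hyperbolic plane in the Poincaré disc model: the unit disc $\{|z|<1\}$ with metric $ds^2=4\frac{dx^2+dy^2}{(1-(x^2+y^2))^2}$. Let $\mathcal P$ be a Poisson point process in the open unit disc whose intensity measure, in Euclidean polar coordinates $(\rho,\theta)$ with $\rho\in(0,1)$, $\theta\in[0,2\pi)$, is $$\mu_\lambda(d\rho,d\theta)=2\lambda\,\frac{1+\rho^2}{(1-\rho^2)^2}\,d\rho\,d\theta.$$ For each $x\in\mathcal P$, let $G_x$ be the hyperbolic line (complete geodesic) that contains $x$ and is orthogonal at $x$ to the Euclidean segment $[0,x]$. Set $\mathcal L=\bigcup_{x\in\mathcal P}G_x$. $L_r(\theta)$ denotes the geodesic segment of hyperbolic length $r$ starting at the origin whose continuation hits the boundary of the disc at $e^{i\theta}$. *)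

(* Defs.v *)
From HB Require Import structures.
From mathcomp Require Import all_boot all_order all_algebra.
From mathcomp Require Import all_classical all_reals all_analysis.
From mathcomp Require Import measurable_realfun.

Set Implicit Arguments.
Unset Strict Implicit.
Unset Printing Implicit Defensive.

Import Order.TTheory GRing.Theory Num.Theory.
Import numFieldNormedType.Exports.

Local Open Scope classical_set_scope.
Local Open Scope ring_scope.

Section HyperbolicPlane.
Context {R : realType}.

Definition disc : set (R * R) := [set z | z.1 ^+ 2 + z.2 ^+ 2 < 1].

(* The Riemannian metric ds^2 = 4 (dx^2 + dy^2) / (1 - (x^2 + y^2))^2, as an
   inner product on the tangent space at [z]. *)
Definition hmetric (z u v : R * R) : R :=
  4 * (u.1 * v.1 + u.2 * v.2) / (1 - (z.1 ^+ 2 + z.2 ^+ 2)) ^+ 2.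

Definition velocity (g : R -> R * R) (t : R) : R * R :=
  (derive1 (fst \o g) t, derive1 (snd \o g) t).

Definition derivable_curve (g : R -> R * R) (t : R) : Prop :=
  derivable (fst \o g) t 1 /\ derivable (snd \o g) t 1.

Definition C1_curve (g : R -> R * R) : Prop :=
  [/\ forall t, derivable_curve g t,
      continuous (derive1 (fst \o g)) & continuous (derive1 (snd \o g))].

Definition hlength (g : R -> R * R) : R :=
  \int[lebesgue_measure]_(t in `[0, 1])
    Num.sqrt (hmetric (g t) (velocity g t) (velocity g t)).

(* Riemannian distance.  A C^1 path on [0, 1] is the restriction of a C^1 curve
   defined on the whole line, of which only the part over [0, 1] has to lie in
   the disc.  Only meaningful for [z] and [w] in the disc. *)
Definition hdist (z w : R * R) : R :=
  inf [set l | exists g : R -> R * R,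
         [/\ C1_curve g, forall t, 0 <= t <= 1 -> disc (g t),
             g 0 = z, g 1 = w & l = hlength g]].

(* Unit-speed geodesics over the parameter set [I]: distance-preserving maps. *)
Definition geodesic (I : set R) (g : R -> R * R) : Prop :=
  (forall t, I t -> disc (g t)) /\
  (forall s t, I s -> I t -> hdist (g s) (g t) = `|s - t|).

(* The line G_x: the complete geodesic through [x] whose velocity at [x] is
   orthogonal to [x], the direction of the segment [0, x].  (At the degenerate
   point [x = 0], which has intensity zero, this is the union of all lines
   through the origin.) *)
Definition perp_line (x : R * R) : set (R * R) :=
  [set z | exists g : R -> R * R,
     [/\ geodesic setT g, g 0 = x, derivable_curve g 0,
         hmetric x (velocity g 0) x = 0 & range g z]].

(* The segment L_r(theta): the part of length [r] of the geodesic ray from the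
   origin that converges to exp(i theta). *)
Definition segment (r theta : R) : set (R * R) :=
  [set z | exists g : R -> R * R,
     [/\ geodesic `[0, +oo[ g, g 0 = (0, 0),
         g t @[t --> +oo] --> (cos theta, sin theta) & (g @` `[0, r]) z]].

Definition line_union (X : set (R * R)) : set (R * R) :=
  \bigcup_(x in X) perp_line x.

Definition visible_directions (X : set (R * R)) (r : R) : set R :=
  [set theta | 0 <= theta < 2 * pi /\
               segment r theta `&` line_union X = set0].

Definition polar (p : R * R) : R * R :=
  (p.1 * cos p.2, p.1 * sin p.2).

(* mu_lambda, transported from the polar coordinates (rho, theta) to the disc. *)
Definition line_intensity (lambda : R) (A : set (R * R)) : \bar R :=
  (\int[lebesgue_measure \x lebesgue_measure]_(p in
      (`]0%R, 1%R[ `*` `[0%R, (2 * pi)%R[) `&` (polar @^-1` A))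
    (2 * lambda * ((1 + p.1 ^+ 2) / (1 - p.1 ^+ 2) ^+ 2))%:E)%E.

End HyperbolicPlane.

Definition num_points {R : realType} {T : Type} (X : T -> set (R * R))
  (A : set (R * R)) : T -> \bar R := fun w => counting (X w `&` A).

(* [X] is a Poisson process on [D] with intensity [mu]: a random locally finite
   subset of [D] whose numbers of points in pairwise disjoint Borel sets are
   independent, the number of points in [A] being Poisson of mean [mu A] (and
   a.s. infinite if [mu A = +oo]).  A random set, rather than a random
   multiset, is the right notion for a diffuse intensity only.  Local finiteness
   is required for every outcome, not just almost surely. *)
Record poisson_process (R : realType) (d : measure_display)
    (T : measurableType d) (P : probability T R) (D : set (R * R))
    (mu : set (R * R) -> \bar R) (X : T -> set (R * R)) : Prop := {
  pp_sub : forall w, X w `<=` D ;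
  pp_locally_finite : forall w (K : set (R * R)),
    compact K -> K `<=` D -> finite_set (X w `&` K) ;
  pp_measurable : forall A : set (R * R), measurable A ->
    measurable_fun [set: T] (num_points X A) ;
  pp_law_fin : forall A : set (R * R), measurable A -> A `<=` D ->
    forall m : R, mu A = m%:E -> forall k : nat,
    P [set w | num_points X A w = k%:R%:E] =
      (expR (- m) * m ^+ k / k`!%:R)%:E ;
  pp_law_infin : forall A : set (R * R), measurable A -> A `<=` D ->
    mu A = +oo%E ->
    P [set w | num_points X A w = +oo%E] = 1%E ;
  pp_indep : forall (n : nat) (A : 'I_n -> set (R * R)) (B : 'I_n -> set (\bar R)),
    (forall i, measurable (A i)) -> trivIset setT A ->
    (forall i, measurable (B i)) ->
    P (\bigcap_(i in setT) [set w | B i (num_points X (A i) w)]) =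
      (\prod_(i < n) P [set w | B i (num_points X (A i) w)])%E }.

(* Main.v *)
Require Import Defs.
From mathcomp Require Import all_boot all_order all_algebra finmap.
From mathcomp Require Import all_classical all_reals all_analysis.
From mathcomp Require Import measurable_realfun.
From mathcomp Require Import ring lra zify.

(**
  Write [S(theta)] for the set of points [x] whose line [G_x] meets the segment
  [L_r(theta)].  In the hyperboloid model both lines and segments become plane
  sections, and [x] is in [S(theta)] iff
  [2 |x|^2 cosh r <= sinh r (x . e_theta) (1 + |x|^2)].  In polar coordinates,
  with the angle integrated last, the radial integral is elementary and its
  value has antiderivative [arsinh (sinh r sin phi)], which gives a Crofton
  formula: [S(theta)] has intensity [2 lambda r], and
  [S(theta') \ S(theta)] has intensity
  [2 lambda arsinh (sinh r sin ((theta' - theta) / 2))].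

  Take about [e^r] equally spaced directions in a sector of angle at most
  [pi / 2].  There a line hitting the segments in two directions hits all
  segments in between, so if [theta_k] is the first direction that is not
  blocked, the lines in [S(theta_j) \ S(theta_k)], [j > k], are independent of
  that event.  Summing over [j], the expected number of unblocked directions is
  the probability that there is one times a quantity comparable to
  [sum_m (1 + m)^(-2 lambda)], which is bounded for [lambda > 1/2] and of order
  [r] for [lambda = 1/2].  For the upper bound the same argument is applied to
  small arcs of directions, [S(theta_k) & S(theta_(k+1))] being the set of lines
  that block a whole arc.
*)

Set Implicit Arguments.
Unset Strict Implicit.
Unset Printing Implicit Defensive.

Import Order.TTheory GRing.Theory Num.Theory.
Import numFieldNormedType.Exports.

Local Open Scope classical_set_scope.
Local Open Scope ring_scope.

(** * Calculus *)

(** Distance is an infimum over curves and a geodesic a distance-preserving map, so neither comes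
    with an equation. The bridge is [cosh (hdist z w) = mink (lift z) (lift w)]. Its hard half, that
    no curve is shorter than the line, compares the curve with the Busemann function of the line's
    ideal endpoint. From then on a geodesic is determined by Minkowski products alone.

    Spacing of order [expR (- r)] is the scale at which [sinh r] times an angle of [m] steps is
    comparable to [m]; there [arsinh] behaves like [ln (1 + m)], which produces the power of
    [1 + m]. In the critical case the sum runs up to about [expR r], hence its size [r].

    In the upper bound a visible direction may fall between two grid directions, which is why arcs
    replace directions; neighbouring directions differ by bounded intensity, so this costs only a
    constant factor. A first void arc near the end of the grid would have too few successors, so it
    is sought in the first half of a grid twice as long. *)

Section Calculus.
Context {R : realType}.
Implicit Types (f g : R -> R) (x a b df dg : R).

(* The library states these rules for operations on functions, such as [f + g];
   the versions below apply to lambda terms. *)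
Lemma is_derivePD f g x df dg : is_derive x 1 f df -> is_derive x 1 g dg ->
  is_derive x 1 (fun t => f t + g t) (df + dg).
Proof. by move=> hf hg; exact: is_deriveD. Qed.

Lemma is_derivePB f g x df dg : is_derive x 1 f df -> is_derive x 1 g dg ->
  is_derive x 1 (fun t => f t - g t) (df - dg).
Proof. by move=> hf hg; exact: is_deriveB. Qed.

Lemma is_derivePM f g x df dg : is_derive x 1 f df -> is_derive x 1 g dg ->
  is_derive x 1 (fun t => f t * g t) (df * g x + f x * dg).
Proof.
move=> hf hg; have := is_deriveM hf hg => /is_derive_eq; apply.
by rewrite /GRing.scale /= addrC [g x * _]mulrC.
Qed.

Lemma is_derivePc a x : is_derive x 1 (fun=> a) 0.
Proof. exact: is_derive_cst. Qed.

Lemma is_derivePZ a f x df : is_derive x 1 f df ->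
  is_derive x 1 (fun t => a * f t) (a * df).
Proof.
move=> hf; have := is_derivePM (is_derivePc a x) hf => /is_derive_eq; apply.
by rewrite mul0r add0r.
Qed.

Lemma is_deriveP_sqr f x df : is_derive x 1 f df ->
  is_derive x 1 (fun t => f t ^+ 2) (2 * f x * df).
Proof.
move=> hf; have := is_derivePM hf hf => /is_derive_eq; apply.
by rewrite mulrC -mulrDl mulr_natl mulr2n.
Qed.

Lemma is_derivePdiv f g x df dg : g x != 0 ->
  is_derive x 1 f df -> is_derive x 1 g dg ->
  is_derive x 1 (fun t => f t / g t) ((df * g x - f x * dg) / g x ^+ 2).
Proof.
move=> g0 hf hg; have hV := is_deriveV g0 hg.
have := is_derivePM hf hV => /is_derive_eq; apply.
by rewrite /GRing.scale /=; field.
Qed.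

Lemma is_deriveP_comp f g x df dg : is_derive (g x) 1 f df ->
  is_derive x 1 g dg -> is_derive x 1 (fun t => f (g t)) (df * dg).
Proof. exact: is_derive1_comp. Qed.

Lemma is_derive_continuous f x df : is_derive x 1 f df ->
  {for x, continuous f}.
Proof. by move=> h; apply/differentiable_continuous/derivable1_diffP. Qed.

Lemma continuousPc a x : {for x, continuous (fun=> a : R)}.
Proof. exact: cvg_cst. Qed.

Lemma continuousPD f g x : {for x, continuous f} -> {for x, continuous g} ->
  {for x, continuous (fun t => f t + g t)}.
Proof. exact: cvgD. Qed.

Lemma continuousPB f g x : {for x, continuous f} -> {for x, continuous g} ->
  {for x, continuous (fun t => f t - g t)}.
Proof. exact: cvgB. Qed.

Lemma continuousPM f g x : {for x, continuous f} -> {for x, continuous g} ->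
  {for x, continuous (fun t => f t * g t)}.
Proof. exact: cvgM. Qed.

Lemma continuousPV f x : f x != 0 -> {for x, continuous f} ->
  {for x, continuous (fun t => (f t)^-1)}.
Proof. exact: cvgV. Qed.

Lemma continuousPX f n x : {for x, continuous f} ->
  {for x, continuous (fun t => f t ^+ n)}.
Proof. by move=> h; exact: (continuous_comp h (@exprn_continuous R n _)). Qed.

Lemma continuousPsqrt f x : {for x, continuous f} ->
  {for x, continuous (fun t => Num.sqrt (f t))}.
Proof. by move=> h; exact: (continuous_comp h (@sqrt_continuous R _)). Qed.

Lemma continuous_at_within f a b :
  (forall x, a <= x <= b -> {for x, continuous f}) ->
  {within `[a, b], continuous f}.
Proof.
move=> h; apply: continuous_in_subspaceT => x.
by rewrite inE /= in_itv /= => /h.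
Qed.

Lemma continuous_integrable_itv f a b :
  (forall x, a <= x <= b -> {for x, continuous f}) ->
  lebesgue_measure.-integrable `[a, b] (EFin \o f).
Proof.
move=> h; apply: continuous_compact_integrable; first exact: segment_compact.
exact: continuous_at_within.
Qed.

Lemma FTC_closed f g a b : a < b ->
  (forall x, a <= x <= b -> is_derive x 1 g (f x)) ->
  (forall x, a <= x <= b -> {for x, continuous f}) ->
  (\int[lebesgue_measure]_(x in `[a, b]) (f x)%:E = (g b - g a)%:E)%E.
Proof.
move=> ab dg cf.
have cg x : a <= x <= b -> {for x, continuous g}.
  by move=> /dg; exact: is_derive_continuous.
rewrite (@continuous_FTC2 _ f g) //.
- exact: continuous_at_within.
- split.
  + by move=> x; rewrite in_itv /= => /andP[/ltW ax /ltW xb];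
      have [] := dg x; rewrite ?ax.
  + by apply: cvg_at_right_filter; apply: cg; rewrite lexx ltW.
  + by apply: cvg_at_left_filter; apply: cg; rewrite lexx ltW.
- move=> x; rewrite in_itv /= => /andP[/ltW ax /ltW xb].
  have := dg x; rewrite ax xb => /(_ isT)[_ dgx].
  by rewrite derive1E dgx.
Qed.

Lemma le_Rintegral_FTC f g s a b : a < b ->
  (forall x, a <= x <= b -> is_derive x 1 g (f x)) ->
  (forall x, a <= x <= b -> {for x, continuous f}) ->
  (forall x, a <= x <= b -> {for x, continuous s}) ->
  (forall x, a <= x <= b -> f x <= s x) ->
  g b - g a <= \int[lebesgue_measure]_(x in `[a, b]) s x.
Proof.
move=> ab dg cf cs fs.
have -> : g b - g a = \int[lebesgue_measure]_(x in `[a, b]) f x.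
  by rewrite /Rintegral (FTC_closed _ dg).
apply: le_Rintegral => //; try exact: continuous_integrable_itv.
Qed.

End Calculus.

Arguments continuousPc {R} a x.
Arguments is_derivePc {R} a x.

(** * Hyperbolic functions *)

Section HyperbolicFunctions.
Context {R : realType}.
Implicit Types s t : R.

Definition cosh t : R := (expR t + expR (- t)) / 2.
Definition sinh t : R := (expR t - expR (- t)) / 2.

Lemma coshD_sinh t : cosh t + sinh t = expR t.
Proof. by rewrite /cosh /sinh; field. Qed.

Lemma coshB_sinh t : cosh t - sinh t = expR (- t).
Proof. by rewrite /cosh /sinh; field. Qed.

Lemma cosh2_sinh2 t : cosh t ^+ 2 = 1 + sinh t ^+ 2.
Proof.
have : expR t * expR (- t) = 1 by rewrite -expRD subrr expR0.
by rewrite /cosh /sinh => h; lra.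
Qed.

Lemma cosh0 : cosh 0 = 1.
Proof. by rewrite /cosh oppr0 expR0; field. Qed.

Lemma sinh0 : sinh 0 = 0.
Proof. by rewrite /sinh oppr0 expR0 subrr mul0r. Qed.

Lemma coshN t : cosh (- t) = cosh t.
Proof. by rewrite /cosh opprK addrC. Qed.

Lemma sinhN t : sinh (- t) = - sinh t.
Proof. by rewrite /sinh opprK -mulNr opprB. Qed.

Lemma coshB s t : cosh (s - t) = cosh s * cosh t - sinh s * sinh t.
Proof. by rewrite /cosh /sinh opprB !expRD; field. Qed.

Lemma cosh_gt0 t : 0 < cosh t.
Proof. by rewrite divr_gt0 // addr_gt0 ?expR_gt0. Qed.

Lemma sinh_gt0 t : 0 < t -> 0 < sinh t.
Proof. by move=> t0; rewrite divr_gt0 // subr_gt0 ltr_expR; lra. Qed.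

Lemma sinh_ge0 t : 0 <= t -> 0 <= sinh t.
Proof. by rewrite le_eqVlt => /predU1P[<-|/sinh_gt0/ltW//]; rewrite sinh0. Qed.

Lemma sinh_neq0 t : t != 0 -> sinh t != 0.
Proof.
move=> /eqP t0; have [/sinh_gt0|] := ltP 0 t; first by move=> /lt0r_neq0.
move=> ?; have /sinh_gt0 : 0 < - t by lra.
by rewrite sinhN => ?; apply/ltr0_neq0; lra.
Qed.

Lemma cosh_abs t : cosh `|t| = cosh t.
Proof. by case: (ger0P t); rewrite ?coshN. Qed.

Lemma cosh_surj b : 1 <= b -> exists2 t : R, 0 <= t & cosh t = b.
Proof.
move=> b1; set q := Num.sqrt (b ^+ 2 - 1).
have q2 : q ^+ 2 = b ^+ 2 - 1 by rewrite sqr_sqrtr //; nra.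
have q0 : 0 <= q by exact: sqrtr_ge0.
have h : 1 <= b + q by lra.
exists (ln (b + q)); first by rewrite ln_ge0.
rewrite /cosh expRN lnK ?posrE; last by lra.
rewrite (_ : (b + q)^-1 = b - q); first by field.
by apply: (mulfI (x := b + q)); [rewrite gt_eqF; lra | rewrite mulfV; [lra | rewrite gt_eqF; lra]].
Qed.

Lemma is_derive_cosh t : is_derive t 1 cosh (sinh t).
Proof.
have hN : is_derive t 1 (fun u => expR (- u)) (expR (- t) * -1).
  exact: (is_deriveP_comp (g := -%R)).
have := is_derivePM (is_derivePD (is_derive_expR t) hN) (is_derivePc 2^-1 t).
by move=> /is_derive_eq; apply; rewrite mulr0 addr0 mulrN1.
Qed.

Lemma is_derive_sinh t : is_derive t 1 sinh (cosh t).
Proof.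
have hN : is_derive t 1 (fun u => expR (- u)) (expR (- t) * -1).
  exact: (is_deriveP_comp (g := -%R)).
have := is_derivePM (is_derivePB (is_derive_expR t) hN) (is_derivePc 2^-1 t).
by move=> /is_derive_eq; apply; rewrite mulr0 addr0 mulrN1 opprK.
Qed.

Lemma continuous_cosh : continuous cosh.
Proof. by move=> t; apply: is_derive_continuous; exact: is_derive_cosh. Qed.

Lemma continuous_sinh : continuous sinh.
Proof. by move=> t; apply: is_derive_continuous; exact: is_derive_sinh. Qed.

End HyperbolicFunctions.

(** * The hyperboloid model *)

Section Hyperboloid.
Context {R : realType}.
Implicit Types (z w : R * R) (p q : R * (R * R)).

Definition sqn z := z.1 ^+ 2 + z.2 ^+ 2.

(** Inverse of the stereographic projection [proj] from [(-1, (0, 0))]; its image is the sheet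
    [future] of the hyperboloid. *)
Definition lift z : R * (R * R) :=
  ((1 + sqn z) / (1 - sqn z),
   (2 * z.1 / (1 - sqn z), 2 * z.2 / (1 - sqn z))).

Definition proj p : R * R := (p.2.1 / (1 + p.1), p.2.2 / (1 + p.1)).

Definition mink p q := p.1 * q.1 - (p.2.1 * q.2.1 + p.2.2 * q.2.2).

Definition future p := 0 < p.1 /\ mink p p = 1.

Lemma disc_gt0 z : disc z -> 0 < 1 - sqn z.
Proof. by rewrite /disc /sqn /= => ?; lra. Qed.

Lemma sqn_ge0 z : 0 <= sqn z.
Proof. by rewrite addr_ge0 ?sqr_ge0. Qed.

Lemma future_lift z : disc z -> future (lift z).
Proof.
move=> /disc_gt0 h; have := sqn_ge0 z; split => /=; first by rewrite divr_gt0 //; lra.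
move: h; rewrite /mink /lift /sqn /= => h; field.
by rewrite gt_eqF //; lra.
Qed.

Lemma disc_proj p : future p -> disc (proj p).
Proof.
case: p => a [b c] []; rewrite /mink /disc /proj /= => a0 e.
have -> : (b / (1 + a)) ^+ 2 + (c / (1 + a)) ^+ 2 = (a - 1) / (1 + a).
  have -> : (b / (1 + a)) ^+ 2 + (c / (1 + a)) ^+ 2 =
    (b * b + c * c) / (1 + a) ^+ 2 by field; rewrite gt_eqF; lra.
  have -> : b * b + c * c = (a - 1) * (1 + a) by lra.
  by field; rewrite gt_eqF; lra.
by rewrite ltr_pdivrMr; lra.
Qed.

Lemma projK p : future p -> lift (proj p) = p.
Proof.
case: p => a [b c] []; rewrite /mink /lift /proj /sqn /= => a0 e.
have -> : (b / (1 + a)) ^+ 2 + (c / (1 + a)) ^+ 2 = (a - 1) / (1 + a).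
  have -> : (b / (1 + a)) ^+ 2 + (c / (1 + a)) ^+ 2 =
    (b * b + c * c) / (1 + a) ^+ 2 by field; rewrite gt_eqF; lra.
  have -> : b * b + c * c = (a - 1) * (1 + a) by lra.
  by field; rewrite gt_eqF; lra.
have -> : 1 - (a - 1) / (1 + a) = 2 / (1 + a) by field; rewrite gt_eqF; lra.
by congr (_, (_, _)); field; rewrite gt_eqF; lra.
Qed.

Lemma liftK z : disc z -> proj (lift z) = z.
Proof.
case: z => x y /disc_gt0; rewrite /lift /proj /sqn /= => h.
by congr (_, _); field; rewrite gt_eqF ?andbT; lra.
Qed.

(** Reverse Cauchy-Schwarz inequality. By Lagrange's identity the squared product of the time
    coordinates exceeds the square of [1 + b * b' + c * c'] by a sum of three squares; their
    vanishing gives [mink_eq1]. *)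
Lemma mink_ge1 p q : future p -> future q -> 1 <= mink p q.
Proof.
case: p q => a [b c] [a' [b' c']] [] /= a0 ep [] /= a'0 eq.
move: ep eq; rewrite /mink /= => ep eq.
have h1 : (a * a') ^+ 2 = (1 + b * b' + c * c') ^+ 2 + (b - b') ^+ 2 +
    (c - c') ^+ 2 + (b * c' - c * b') ^+ 2.
  have -> : (a * a') ^+ 2 = (1 + (b * b + c * c)) * (1 + (b' * b' + c' * c')).
    have -> : 1 + (b * b + c * c) = a * a by lra.
    have -> : 1 + (b' * b' + c' * c') = a' * a' by lra.
    by ring.
  by ring.
have h2 : (1 + b * b' + c * c') ^+ 2 <= (a * a') ^+ 2.
  by rewrite h1 -!addrA lerDl !addr_ge0 ?sqr_ge0.
have h3 : 0 <= a * a' by rewrite mulr_ge0 // ltW.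
have h4 : 1 + b * b' + c * c' <= a * a'.
  by apply: le_trans (ler_norm _) _; rewrite -ler_sqr ?nnegrE // real_normK ?num_real.
by lra.
Qed.

Lemma mink_eq1 p q : future p -> future q -> mink p q = 1 -> p = q.
Proof.
case: p q => a [b c] [a' [b' c']] [] /= a0 ep [] /= a'0 eq.
move: ep eq; rewrite /mink /= => ep eq e.
have h1 : (a * a') ^+ 2 = (1 + b * b' + c * c') ^+ 2 + (b - b') ^+ 2 +
    (c - c') ^+ 2 + (b * c' - c * b') ^+ 2.
  have -> : (a * a') ^+ 2 = (1 + (b * b + c * c)) * (1 + (b' * b' + c' * c')).
    have -> : 1 + (b * b + c * c) = a * a by lra.
    have -> : 1 + (b' * b' + c' * c') = a' * a' by lra.
    by ring.
  by ring.
have h2 : (a * a') = (1 + b * b' + c * c') by lra.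
move: h1; rewrite h2 => h1.
have := sqr_ge0 (b - b'); have := sqr_ge0 (c - c').
have := sqr_ge0 (b * c' - c * b') => s1 s2 s3.
have /eqP : (b - b') ^+ 2 = 0 by lra.
have /eqP : (c - c') ^+ 2 = 0 by lra.
rewrite !sqrf_eq0 !subr_eq0 => /eqP ec /eqP eb; subst b' c'.
congr (_, _); apply/eqP; rewrite -(eqrXn2 (n := 2)) ?ltW //; apply/eqP; lra.
Qed.

(** Such a vector stands for a point at infinity, the centre of the horocycles on which [mink n] is
    constant. *)
Definition null_cone (n : R * (R * R)) := 0 < n.1 /\ mink n n = 0.

Lemma hlength_ge0 (g : R -> R * R) : 0 <= hlength g.
Proof. by apply: Rintegral_ge0 => t _; exact: sqrtr_ge0. Qed.

Lemma mink_null_lift n z : disc z ->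
  mink n (lift z) = (n.1 * (1 + sqn z) - 2 * (n.2.1 * z.1 + n.2.2 * z.2)) / (1 - sqn z).
Proof.
move=> /disc_gt0 h; rewrite /mink /lift /=; field.
by rewrite gt_eqF.
Qed.

(** With [q] the squared norm of [z], Cauchy-Schwarz bounds the scalar product by [n.1 * sqrt q],
    and [2 * sqrt q < 1 + q] when [q < 1]. This makes the logarithm of [mink n] meaningful along a
    curve in the disc. *)
Lemma null_lift_gt0 n z : null_cone n -> disc z ->
  0 < n.1 * (1 + sqn z) - 2 * (n.2.1 * z.1 + n.2.2 * z.2).
Proof.
case: n z => n0 [n1 n2] [x y] [/=]; rewrite /mink /= /sqn /= => n00 e.
move=> /disc_gt0; rewrite /sqn /= => q1.
set q := x ^+ 2 + y ^+ 2; have q0 : 0 <= q by rewrite /q addr_ge0 ?sqr_ge0.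
have cs : (n1 * x + n2 * y) ^+ 2 <= n0 ^+ 2 * q.
  have -> : n0 ^+ 2 = n1 ^+ 2 + n2 ^+ 2 by lra.
  by have := sqr_ge0 (n1 * y - n2 * x); rewrite /q; lra.
have q2 : 0 < (1 - q) ^+ 2 by rewrite exprn_gt0 //; rewrite /q; lra.
have n02 : 0 < n0 ^+ 2 by rewrite exprn_gt0.
have h : (2 * (n1 * x + n2 * y)) ^+ 2 < (n0 * (1 + q)) ^+ 2.
  by have := mulr_gt0 n02 q2; lra.
rewrite subr_gt0; apply: le_lt_trans (ler_norm _) _.
rewrite -ltr_sqr ?nnegrE ?real_normK ?num_real //.
by rewrite mulr_ge0 ?ltW //; lra.
Qed.

(* The logarithm of [mink n] is a Busemann function, whose gradient has norm
   exactly 1. *)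
Lemma hlength_busemann n (g : R -> R * R) : null_cone n -> C1_curve g ->
  (forall t : R, 0 <= t <= 1 -> disc (g t)) ->
  ln (mink n (lift (g 0))) - ln (mink n (lift (g 1))) <= hlength g.
Proof.
move=> nn [dg cx cy] gd.
set x : R -> R := fst \o g; set y : R -> R := snd \o g.
set D : R -> R := fun t => n.1 * (1 + (x t ^+ 2 + y t ^+ 2)) - 2 * (n.2.1 * x t + n.2.2 * y t).
set E : R -> R := fun t => 1 - (x t ^+ 2 + y t ^+ 2).
have D0 t : 0 <= t <= 1 -> 0 < D t by move=> /gd; exact: null_lift_gt0.
have E0 t : 0 <= t <= 1 -> 0 < E t by move=> /gd/disc_gt0.
set x' : R -> R := derive1 x; set y' : R -> R := derive1 y.
have dx (t : R) : is_derive t 1 x (x' t).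
  by rewrite /x' derive1E; apply: derivableP; have [] := dg t.
have dy (t : R) : is_derive t 1 y (y' t).
  by rewrite /y' derive1E; apply: derivableP; have [] := dg t.
set q' : R -> R := fun t => 2 * x t * x' t + 2 * y t * y' t.
have dq (t : R) : is_derive t 1 (fun t => x t ^+ 2 + y t ^+ 2) (q' t).
  by apply: is_derivePD; exact: is_deriveP_sqr.
set D' : R -> R := fun t => n.1 * (0 + q' t) - 2 * (n.2.1 * x' t + n.2.2 * y' t).
set E' : R -> R := fun t => 0 - q' t.
have dD (t : R) : is_derive t 1 D (D' t).
  exact: is_derivePB.
have dE (t : R) : is_derive t 1 E (E' t).
  exact: is_derivePB.
set F : R -> R := fun t => ln (E t) - ln (D t).
set f : R -> R := fun t => (E t)^-1 * E' t - (D t)^-1 * D' t.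
have dF (t : R) : 0 <= t <= 1 -> is_derive t 1 F (f t).
  move=> t01; apply: is_derivePB.
    exact: (is_deriveP_comp (is_derive1_ln (E0 _ t01)) (dE t)).
  exact: (is_deriveP_comp (is_derive1_ln (D0 _ t01)) (dD t)).
have kx (t : R) : {for t, continuous x} by exact: is_derive_continuous (dx t).
have ky (t : R) : {for t, continuous y} by exact: is_derive_continuous (dy t).
have kE (t : R) : {for t, continuous E} by exact: is_derive_continuous (dE t).
have kD (t : R) : {for t, continuous D} by exact: is_derive_continuous (dD t).
have kx' (t : R) : {for t, continuous x'} by exact: cx.
have ky' (t : R) : {for t, continuous y'} by exact: cy.
have kq' (t : R) : {for t, continuous q'}.
  have := (continuousPD (continuousPM (continuousPM (continuousPc 2 t) (kx t)) (kx' t))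
                       (continuousPM (continuousPM (continuousPc 2 t) (ky t)) (ky' t))). by [].
have kE' (t : R) : {for t, continuous E'}.
  exact: (continuousPB (continuousPc 0 t) (kq' t)).
have kD' (t : R) : {for t, continuous D'}.
  exact: (continuousPB
    (continuousPM (continuousPc n.1 t) (continuousPD (continuousPc 0 t) (kq' t)))
    (continuousPM (continuousPc 2 t)
       (continuousPD (continuousPM (continuousPc n.2.1 t) (kx' t))
                     (continuousPM (continuousPc n.2.2 t) (ky' t))))).
have kf (t : R) : 0 <= t <= 1 -> {for t, continuous f}.
  move=> t01.
  by apply: (continuousPB (continuousPM (continuousPV _ (kE t)) (kE' t))
       (continuousPM (continuousPV _ (kD t)) (kD' t))); rewrite gt_eqF ?E0 ?D0.
rewrite !mink_null_lift; try by apply: gd; lra.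
rewrite !ln_div ?posrE; try by (apply: D0; lra) || (apply: E0; lra).
rewrite -/(sqn _).
have -> : forall a b c d : R, a - b - (c - d) = (d - c) - (b - a) by move=> *; ring.
have -> : hlength g = \int[lebesgue_measure]_(t in `[0, 1])
   Num.sqrt (4 * (x' t ^+ 2 + y' t ^+ 2) / E t ^+ 2).
  by apply: eq_Rintegral => t _; rewrite /hmetric /E /= -!expr2.
apply: (le_Rintegral_FTC (g := F)) dF kf _ _ => [//||t t01].
  move=> t t01; apply: continuousPsqrt; apply: continuousPM.
    apply: (continuousPM (continuousPc 4 t)).
    exact: (continuousPD (continuousPX (n := 2) (kx' t)) (continuousPX (n := 2) (ky' t))).
  apply: continuousPV; last exact: continuousPX.
  by rewrite expf_neq0 // gt_eqF ?E0.
apply: le_trans (ler_norm _) _; rewrite -sqrtr_sqr; apply: ler_wsqrtr.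
have {}D0 := D0 _ t01; have {}E0 := E0 _ t01.
have -> : f t ^+ 2 = (E' t * D t - D' t * E t) ^+ 2 / D t ^+ 2 / E t ^+ 2.
  by rewrite /f; field; rewrite !gt_eqF.
rewrite ler_pM2r ?invr_gt0 ?exprn_gt0 // ler_pdivrMr ?exprn_gt0 //.
case: nn => n0; rewrite /mink => ne.
(* Up to the factor [- 2 / (D t * E t)], the vector [(a1, a2)] is the Euclidean gradient of the
   function whose values along the curve are [F]. Its norm is [D t] because [n] is null, and
   Cauchy-Schwarz against the velocity leaves the conformal factor [2 / E t]. *)
set a1 := x t * (n.1 * E t + D t) - E t * n.2.1.
set a2 := y t * (n.1 * E t + D t) - E t * n.2.2.
have -> : E' t * D t - D' t * E t = - 2 * (a1 * x' t + a2 * y' t).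
  by rewrite /a1 /a2 /E' /D' /q'; ring.
have -> : D t ^+ 2 = a1 ^+ 2 + a2 ^+ 2.
  have -> : a1 ^+ 2 + a2 ^+ 2 = D t ^+ 2 - E t ^+ 2 * (n.1 * n.1 - (n.2.1 * n.2.1 + n.2.2 * n.2.2)).
    rewrite /a1 /a2 /D /E; ring.
  by rewrite ne mulr0 subr0.
by have := sqr_ge0 (a1 * y' t - a2 * x' t); lra.
Qed.

End Hyperboloid.

(** * Unit-speed lines of the hyperboloid and the length of their projections *)

Section HyperbolicDistance.
Context {R : realType}.
Implicit Types (z w : R * R) (p q P V : R * (R * R)) (a b d s t : R).

Definition unit_tangent P V := mink P V = 0 /\ mink V V = -1.

Definition hline P V t : R * (R * R) :=
  (cosh t * P.1 + sinh t * V.1,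
   (cosh t * P.2.1 + sinh t * V.2.1, cosh t * P.2.2 + sinh t * V.2.2)).

Lemma mink_hline P V s t : future P -> unit_tangent P V ->
  mink (hline P V s) (hline P V t) = cosh (s - t).
Proof.
move=> [_ PP] [PV VV]; rewrite coshB.
transitivity (cosh s * cosh t * mink P P + sinh s * sinh t * mink V V +
    (cosh s * sinh t + sinh s * cosh t) * mink P V).
  by rewrite /mink /hline /=; ring.
by rewrite PP VV PV; ring.
Qed.

(** Cauchy-Schwarz on the spatial parts. It makes both null vectors [P + V] and [P - V] point to the
    future; [hline P V t] combines them with weights [expR t / 2] and [expR (- t) / 2], so it never
    leaves the sheet. *)
Lemma unit_tangent_lt P V : future P -> unit_tangent P V -> `|V.1| < P.1.
Proof.
case: P V => [a [b c]] [a' [b' c']] [] /= a0; rewrite /unit_tangent /mink /=.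
move=> ep [e0 eV]; rewrite -ltr_sqr ?nnegrE ?(ltW a0) // real_normK ?num_real //.
have e2 : (a * a') ^+ 2 = (b * b' + c * c') ^+ 2 by congr (_ ^+ 2); lra.
have := sqr_ge0 (b * c' - c * b') => cs.
have : a ^+ 2 * a' ^+ 2 <= (a ^+ 2 - 1) * (1 + a' ^+ 2).
  have -> : a ^+ 2 - 1 = b ^+ 2 + c ^+ 2 by lra.
  have -> : 1 + a' ^+ 2 = b' ^+ 2 + c' ^+ 2 by lra.
  by lra.
by lra.
Qed.

Lemma future_hline P V t : future P -> unit_tangent P V -> future (hline P V t).
Proof.
move=> fP tV; split; last by rewrite mink_hline // subrr cosh0.
have := unit_tangent_lt fP tV; rewrite ltr_norml => /andP[h1 h2] /=.
have := expR_gt0 t; rewrite -coshD_sinh => e1.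
have := expR_gt0 (- t); rewrite -coshB_sinh => e2.
have h1' : 0 < P.1 + V.1 by lra.
have h2' : 0 < P.1 - V.1 by lra.
by have := mulr_gt0 e1 h1'; have := mulr_gt0 e2 h2'; lra.
Qed.

Lemma hline0 P V : hline P V 0 = P.
Proof.
by case: P => a [b c]; rewrite /hline /= cosh0 sinh0 !mul0r !addr0 !mul1r.
Qed.

(** Each coordinate of [hline P V (d * t)] has this form. The parameter is scaled by [d] because
    [hlength] integrates over [[0, 1]] only. *)
Definition hcomb a b d t : R := cosh (d * t) * a + sinh (d * t) * b.
Definition hcomb' a b d t : R := d * (sinh (d * t) * a + cosh (d * t) * b).

Lemma is_derive_hcomb a b d t : is_derive t 1 (hcomb a b d) (hcomb' a b d t).
Proof.
have hd : is_derive t 1 (fun u => d * u) (d * 1).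
  exact: is_derivePZ (is_derive_id t 1).
have hc := is_deriveP_comp (is_derive_cosh (d * t)) hd.
have hs := is_deriveP_comp (is_derive_sinh (d * t)) hd.
have := is_derivePD (is_derivePM hc (is_derivePc a t)) (is_derivePM hs (is_derivePc b t)).
by move=> /is_derive_eq; apply; rewrite /hcomb' ; ring.
Qed.

Lemma continuous_hcomb a b d : continuous (hcomb a b d).
Proof. by move=> t; exact: is_derive_continuous (is_derive_hcomb a b d t). Qed.

Arguments continuous_hcomb : clear implicits.

Lemma continuous_hcomb' a b d : continuous (hcomb' a b d).
Proof.
move=> t; suff : {for t, continuous (hcomb' a b d)} by [].
have -> : hcomb' a b d = (fun u => d * hcomb b a d u).
  by apply/funext => u; rewrite /hcomb' /hcomb addrC.
exact: continuousPM (continuousPc d t) (continuous_hcomb b a d t).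
Qed.

Arguments continuous_hcomb' : clear implicits.

Section ProjectedLine.
Context (P V : R * (R * R)) (d : R) (fP : future P) (tV : unit_tangent P V).

Let pline t : R * R := proj (hline P V (d * t)).
Let c := hcomb P.1 V.1 d.
Let c' := hcomb' P.1 V.1 d.

Let c_gt0 t : 0 < c t.
Proof. by have [] := future_hline (d * t) fP tV. Qed.

Let dquot a b (t : R) : R :=
  (hcomb' a b d t * (1 + c t) - hcomb a b d t * (0 + c' t)) / (1 + c t) ^+ 2.

Let is_derive_quot a b t :
  is_derive t 1 (fun u => hcomb a b d u / (1 + c u)) (dquot a b t).
Proof.
apply: is_derivePdiv; first by rewrite gt_eqF // addr_gt0.
  exact: is_derive_hcomb.
exact: is_derivePD (is_derivePc 1 t) (is_derive_hcomb _ _ _ _).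
Qed.

Let continuous_dquot a b : continuous (dquot a b).
Proof.
move=> t; suff : {for t, continuous (dquot a b)} by [].
have k1 : {for t, continuous (fun u => 1 + c u)}.
  exact: continuousPD (continuousPc 1 t) (continuous_hcomb _ _ _ t).
have k0 : {for t, continuous (fun u => 0 + c' u)}.
  exact: continuousPD (continuousPc 0 t) (continuous_hcomb' _ _ _ t).
apply: continuousPM.
  exact: continuousPB (continuousPM (continuous_hcomb' a b d t) k1)
                      (continuousPM (continuous_hcomb a b d t) k0).
apply: continuousPV (continuousPX k1).
by rewrite expf_neq0 // gt_eqF // addr_gt0.
Qed.

Let fst_pline t : is_derive t 1 (fst \o pline) (dquot P.2.1 V.2.1 t).
Proof. exact: is_derive_quot. Qed.

Let snd_pline t : is_derive t 1 (snd \o pline) (dquot P.2.2 V.2.2 t).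
Proof. exact: is_derive_quot. Qed.

Let derive_fst : derive1 (fst \o pline) = dquot P.2.1 V.2.1.
Proof. by apply/funext => t; rewrite derive1E; have [_ ->] := fst_pline t. Qed.

Let derive_snd : derive1 (snd \o pline) = dquot P.2.2 V.2.2.
Proof. by apply/funext => t; rewrite derive1E; have [_ ->] := snd_pline t. Qed.

Lemma C1_pline : C1_curve pline.
Proof.
split; rewrite ?derive_fst ?derive_snd; try exact: continuous_dquot.
by move=> t; split; [have [] := fst_pline t|have [] := snd_pline t].
Qed.

Lemma velocity_pline0 : velocity pline 0 =
  (d * (V.2.1 * (1 + P.1) - P.2.1 * V.1) / (1 + P.1) ^+ 2,
   d * (V.2.2 * (1 + P.1) - P.2.2 * V.1) / (1 + P.1) ^+ 2).
Proof.
rewrite /velocity derive_fst derive_snd /dquot /c /c' /hcomb /hcomb'.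
rewrite !mulr0 cosh0 sinh0 !mul0r !mul1r !add0r !addr0.
by congr (_ / _, _ / _); ring.
Qed.

Lemma hlength_pline : hlength pline = `|d|.
Proof.
have speed t : Num.sqrt (hmetric (pline t) (velocity pline t) (velocity pline t)) = `|d|.
  rewrite -sqrtr_sqr; congr Num.sqrt.
  rewrite /hmetric /velocity derive_fst derive_snd /pline /proj /=.
  rewrite -!/(hcomb _ _ d t) -/(c t) /dquot.
  have ct := c_gt0 t.
  have : mink (hline P V (d * t)) (hline P V (d * t)) = 1.
    by rewrite mink_hline // subrr cosh0.
  have PP : mink P P = 1 by case: fP.
  have [PV VV] := tV.
  have CS := cosh2_sinh2 (d * t).
  (* The velocity on the hyperboloid is Minkowski-orthogonal to the point and has square [- d ^+ 2].
     Together with the equation of the hyperboloid this determines the speed in the disc, so the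
     coordinates are then generalised to free variables. *)
  have : c t * c' t - (hcomb P.2.1 V.2.1 d t * hcomb' P.2.1 V.2.1 d t +
                       hcomb P.2.2 V.2.2 d t * hcomb' P.2.2 V.2.2 d t) = 0.
    transitivity (d * (cosh (d * t) * sinh (d * t) * (mink P P + mink V V) +
       (cosh (d * t) ^+ 2 + sinh (d * t) ^+ 2) * mink P V)).
      by rewrite /c /c' /hcomb /hcomb' /mink; ring.
    by rewrite PP VV PV; ring.
  have : c' t ^+ 2 - (hcomb' P.2.1 V.2.1 d t ^+ 2 + hcomb' P.2.2 V.2.2 d t ^+ 2) = - d ^+ 2.
    transitivity (d ^+ 2 * (sinh (d * t) ^+ 2 * mink P P + cosh (d * t) ^+ 2 * mink V V
       + 2 * (cosh (d * t) * sinh (d * t)) * mink P V)).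
      by rewrite /c /c' /hcomb /hcomb' /mink; ring.
    by rewrite PP VV PV CS; ring.
  rewrite /mink /hline /= -!/(hcomb _ _ d t) -/(c t).
  move: (hcomb _ _ d t) (hcomb' _ _ d t) (hcomb _ _ d t) (hcomb' _ _ d t) (c t) (c' t) ct.
  move=> y y' x x' u u' u0 e1 e2 e3.
  have -> : 1 - ((x / (1 + u)) ^+ 2 + (y / (1 + u)) ^+ 2) = 2 / (1 + u).
    have -> : (x / (1 + u)) ^+ 2 + (y / (1 + u)) ^+ 2 =
      (x * x + y * y) / (1 + u) ^+ 2 by field; rewrite gt_eqF; lra.
    have -> : x * x + y * y = (u - 1) * (1 + u) by lra.
    by field; rewrite gt_eqF; lra.
  have -> : d ^+ 2 = d ^+ 2 * (1 + u) ^+ 2 / (1 + u) ^+ 2.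
    by field; rewrite gt_eqF; lra.
  have -> : d ^+ 2 * (1 + u) ^+ 2 =
     (x' * (1 + u) - x * u') ^+ 2 + (y' * (1 + u) - y * u') ^+ 2.
    have -> : (x' * (1 + u) - x * u') ^+ 2 + (y' * (1 + u) - y * u') ^+ 2 =
      (x' ^+ 2 + y' ^+ 2) * (1 + u) ^+ 2 - 2 * (1 + u) * u' * (x * x' + y * y')
      + u' ^+ 2 * (x * x + y * y) by ring.
    have -> : x' ^+ 2 + y' ^+ 2 = u' ^+ 2 + d ^+ 2 by lra.
    have -> : x * x' + y * y' = u * u' by lra.
    have -> : x * x + y * y = u * u - 1 by lra.
    by ring.
  by field; rewrite gt_eqF; lra.
rewrite /hlength; under eq_Rintegral do rewrite speed.
rewrite Rintegral_cst //= lebesgue_measure_itv /= lte_fin ltr01.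
by rewrite -EFinB subr0 mulr1.
Qed.

End ProjectedLine.

End HyperbolicDistance.

(** * The Riemannian distance and its isometric parametrisations *)

Section Distance.
Context {R : realType}.
Implicit Types (z w : R * R) (p q P V : R * (R * R)) (a b d s t : R).

Definition arsinh y : R := ln (y + Num.sqrt (1 + y ^+ 2)).

Lemma arsinh_arg_gt0 (y : R) : 0 < y + Num.sqrt (1 + y ^+ 2).
Proof.
have : `|y| < Num.sqrt (1 + y ^+ 2).
  by rewrite -sqrtr_sqr ltr_sqrt ?ltrDr // ltr_wpDr ?sqr_ge0.
by rewrite ltr_norml => /andP[]; lra.
Qed.

Lemma arsinhK : cancel arsinh (@sinh R).
Proof.
move=> y; have y0 := arsinh_arg_gt0 y; rewrite /sinh expRN lnK ?posrE //.
have q2 : Num.sqrt (1 + y ^+ 2) ^+ 2 = 1 + y ^+ 2.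
  by rewrite sqr_sqrtr // addr_ge0 ?sqr_ge0.
rewrite (_ : _^-1 = Num.sqrt (1 + y ^+ 2) - y); first by field.
by apply: (mulfI (lt0r_neq0 y0)); rewrite mulfV ?lt0r_neq0 //; lra.
Qed.

(** Gram-Schmidt: [V] is [q] minus its component along [p], divided by [sinh d]. A negative [d] is
    allowed, as only [cosh d] is prescribed. *)
Lemma future_tangent p q d : future p -> future q -> d != 0 ->
  mink p q = cosh d ->
  exists V, unit_tangent p V /\ hline p V d = q.
Proof.
move=> [_ pp] [_ qq] d0 pq; have s0 := sinh_neq0 d0.
exists ((q.1 - cosh d * p.1) / sinh d,
  ((q.2.1 - cosh d * p.2.1) / sinh d, (q.2.2 - cosh d * p.2.2) / sinh d)).
split; last first.
  case: q {pq qq} => q0 [q1 q2]; rewrite /hline /=.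
  by congr (_, (_, _)); field.
split.
  transitivity ((mink p q - cosh d * mink p p) / sinh d).
    by rewrite /mink /=; field.
  by rewrite pp pq mulr1 subrr mul0r.
transitivity ((mink q q - 2 * cosh d * mink p q + cosh d ^+ 2 * mink p p) / sinh d ^+ 2).
  by rewrite /mink /=; field.
rewrite qq pp pq mulr1 -mulrA -expr2 cosh2_sinh2.
by field.
Qed.

Lemma hlength_cst z : disc z -> hlength (fun=> z) = 0.
Proof.
move=> dz; rewrite /hlength /velocity.
have -> : derive1 (fst \o (fun _ : R => z)) = cst 0 by apply/funext => t; exact: derive1_cst.
have -> : derive1 (snd \o (fun _ : R => z)) = cst 0 by apply/funext => t; exact: derive1_cst.
under eq_Rintegral do rewrite /hmetric /= !mulr0 addr0 mulr0 mul0r sqrtr0.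
by rewrite Rintegral_cst // mul0r.
Qed.

Lemma C1_cst z : C1_curve (fun=> z).
Proof.
have e1 : derive1 (fst \o (fun _ : R => z)) = cst 0 by apply/funext => t; exact: derive1_cst.
have e2 : derive1 (snd \o (fun _ : R => z)) = cst 0 by apply/funext => t; exact: derive1_cst.
split; [|by rewrite e1; exact: cst_continuous|by rewrite e2; exact: cst_continuous].
by move=> t; split; exact: derivable_cst.
Qed.

Lemma cosh_le_hlength z w d (g : R -> R * R) : 0 <= d ->
  mink (lift z) (lift w) = cosh d ->
  C1_curve g -> (forall t : R, 0 <= t <= 1 -> disc (g t)) ->
  g 0 = z -> g 1 = w -> d <= hlength g.
Proof.
rewrite le_eqVlt => /predU1P[<- *|d0 e gC gd gz gw]; first exact: hlength_ge0.
have fz : future (lift z) by rewrite -gz; apply/future_lift/gd; rewrite lexx ler01.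
have fw : future (lift w) by rewrite -gw; apply/future_lift/gd; rewrite lexx ler01.
have [V [tV eV]] := future_tangent fz fw (lt0r_neq0 d0) e.
have [PV VV] := tV; have [P0 PP] := fz.
(* The ideal endpoint of the line from [z] through [w]. For this [n] the value of [mink n] is 1 at
   [z] and [expR (- d)] at [w], so the Busemann bound is exactly [d]. *)
pose n : R * (R * R) :=
  ((lift z).1 + V.1, ((lift z).2.1 + V.2.1, (lift z).2.2 + V.2.2)).
have nn : null_cone n.
  split.
    by have := unit_tangent_lt fz tV; rewrite ltr_norml /= => /andP[]; lra.
  transitivity (mink (lift z) (lift z) + 2 * mink (lift z) V + mink V V).
    by rewrite /mink /=; ring.
  by rewrite PP PV VV; ring.
have := hlength_busemann nn gC gd; rewrite gz gw -eV.
have -> : mink n (lift z) = 1.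
  transitivity (mink (lift z) (lift z) + mink (lift z) V).
    by rewrite /mink /=; ring.
  by rewrite PP PV addr0.
have -> : mink n (hline (lift z) V d) = expR (- d).
  transitivity (cosh d * (mink (lift z) (lift z) + mink (lift z) V) +
     sinh d * (mink (lift z) V + mink V V)).
    by rewrite /mink /=; ring.
  by rewrite PP PV VV -coshB_sinh; ring.
by rewrite ln1 expRK opprK add0r.
Qed.

Lemma hdistE z w d : disc z -> disc w -> 0 <= d ->
  mink (lift z) (lift w) = cosh d -> hdist z w = d.
Proof.
move=> dz dw d0 e; rewrite /hdist; set L := (X in inf X).
have lb : lbound L d.
  by move=> l [g [gC gd gz gw ->]]; exact: (cosh_le_hlength d0 e).
have Ld : L d.
  move: d0 e; rewrite le_eqVlt => /predU1P[<-|d0 e].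
    rewrite cosh0 => /(mink_eq1 (future_lift dz) (future_lift dw)) e.
    have {e} e : w = z by rewrite -(liftK dz) -(liftK dw) e.
    exists (fun=> z); split; rewrite ?e ?hlength_cst //.
    exact: C1_cst.
  have [V [tV eV]] := future_tangent (future_lift dz) (future_lift dw) (lt0r_neq0 d0) e.
  exists (fun t => proj (hline (lift z) V (d * t))).
  have fz := future_lift dz.
  split.
  - exact: C1_pline.
  - by move=> t _; apply/disc_proj/future_hline.
  - by rewrite mulr0 hline0 liftK.
  - by rewrite mulr1 eV liftK.
  - by rewrite hlength_pline // gtr0_norm.
apply/eqP; rewrite eq_le; apply/andP; split.
  by apply: ge_inf => //; exists d.
by apply: lb_le_inf => //; exists d.
Qed.

Lemma cosh_hdist z w : disc z -> disc w ->
  cosh (hdist z w) = mink (lift z) (lift w).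
Proof.
move=> dz dw.
have [d d0 e] := cosh_surj (mink_ge1 (future_lift dz) (future_lift dw)).
by rewrite (hdistE dz dw d0 (esym e)).
Qed.

Lemma geodesic_hline (I : set R) P V : future P -> unit_tangent P V ->
  geodesic I (fun t => proj (hline P V t)).
Proof.
move=> fP tV; split => [t _|s t _ _]; first exact/disc_proj/future_hline.
have f u := future_hline u fP tV.
apply: hdistE => //; try exact: disc_proj.
by rewrite (projK (f s)) (projK (f t)) mink_hline // cosh_abs.
Qed.

(** The Minkowski form is negative definite on the orthogonal complement of a timelike vector. *)
Lemma mink_orth_null p q : future p -> mink p q = 0 -> mink q q = 0 ->
  q = (0, (0, 0)).
Proof.
case: p q => a [b c] [a' [b' c']] []; rewrite /mink /= => a0 ep e0 eq.
have e2 : (a * a') ^+ 2 = (b * b' + c * c') ^+ 2 by congr (_ ^+ 2); lra.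
have := sqr_ge0 (b * c' - c * b') => cs.
have : a ^+ 2 * a' ^+ 2 <= (a ^+ 2 - 1) * a' ^+ 2.
  have -> : a ^+ 2 - 1 = b ^+ 2 + c ^+ 2 by lra.
  have -> : a' ^+ 2 = b' ^+ 2 + c' ^+ 2 by lra.
  have e3 : a' ^+ 2 = b' ^+ 2 + c' ^+ 2 by lra.
  by move: e2; rewrite exprMn e3; lra.
have := sqr_ge0 a'; have := sqr_ge0 b'; have := sqr_ge0 c' => s1 s2 s3 h.
have /eqP : a' ^+ 2 = 0 by lra.
have /eqP : b' ^+ 2 = 0 by lra.
have /eqP : c' ^+ 2 = 0 by lra.
by rewrite !sqrf_eq0 => /eqP -> /eqP -> /eqP ->.
Qed.

(** No smoothness of [g] enters. The point at parameter [d] fixes [V]; the distances to [g 0] and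
    [g d] then dictate the products of [lift (g t)] with [P] and [V], and its difference from
    [hline P V t] is a null vector orthogonal to [P], hence zero. *)
Lemma geodesic_hlineE (I : set R) (g : R -> R * R) d : geodesic I g ->
  I 0 -> I d -> d != 0 ->
  exists V, unit_tangent (lift (g 0)) V /\
    forall t, I t -> lift (g t) = hline (lift (g 0)) V t.
Proof.
move=> [gd gh] I0 Id d0.
have f t : I t -> future (lift (g t)) by move=> /gd/future_lift.
have m s t : I s -> I t -> mink (lift (g s)) (lift (g t)) = cosh (s - t).
  by move=> Is It; rewrite -cosh_hdist ?gh ?cosh_abs //; exact: gd.
have [|V [tV eV]] := future_tangent (f _ I0) (f _ Id) d0.
  by rewrite m // sub0r coshN.
exists V; split => // t It; have [PV VV] := tV.
have [_ PP] := f _ I0.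
set P := lift (g 0) in PV VV PP eV tV *; set q := lift (g t).
have Pq : mink P q = cosh t by rewrite m // sub0r coshN.
have qV : mink q V = - sinh t.
  have : mink q (lift (g d)) = cosh (t - d) by exact: m.
  rewrite -eV coshB => e.
  have : sinh d * mink q V = - (sinh t * sinh d).
    have -> : sinh d * mink q V = mink q (hline P V d) - cosh d * mink P q.
      by rewrite /mink /=; ring.
    by rewrite e Pq; ring.
  by move=> h; apply: (mulfI (sinh_neq0 d0)); rewrite h mulrN mulrC.
have [_ qq] := f _ It.
pose D : R * (R * R) := (q.1 - (hline P V t).1,
  (q.2.1 - (hline P V t).2.1, q.2.2 - (hline P V t).2.2)).
have : D = (0, (0, 0)).
  apply: (mink_orth_null (f _ I0)).
    transitivity (mink P q - cosh t * mink P P - sinh t * mink P V).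
      by rewrite /mink /=; ring.
    by rewrite Pq PP PV; ring.
  transitivity (mink q q + cosh t ^+ 2 * mink P P + sinh t ^+ 2 * mink V V
     - 2 * cosh t * mink P q - 2 * sinh t * mink q V
     + 2 * cosh t * sinh t * mink P V).
    by rewrite /mink /=; ring.
  by have := cosh2_sinh2 t; rewrite qq PP VV Pq qV PV; lra.
rewrite /D; case: q {Pq qV qq D} => q0 [q1 q2] [] /= /eqP.
rewrite subr_eq0 => /eqP -> /eqP; rewrite subr_eq0 => /eqP -> /eqP.
by rewrite subr_eq0 => /eqP ->.
Qed.

End Distance.

(** * Lines and segments *)

Section LinesAndSegments.
Context {R : realType}.
Implicit Types (x z : R * R) (P V : R * (R * R)) (r s t theta : R).

Let origin : R * (R * R) := (1, (0, 0)).
Let dir theta : R * (R * R) := (0, (cos theta, sin theta)).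

Lemma lift0 : lift ((0, 0) : R * R) = (1, (0, 0)).
Proof. by rewrite /lift /sqn /= expr0n /= !addr0 subr0 divr1 mulr0 mul0r. Qed.

Let future_origin : future origin.
Proof. by split; rewrite /mink /origin /= ?ltr01 // !mul0r addr0 subr0 mulr1. Qed.

Let tangent_dir theta : unit_tangent origin (dir theta).
Proof.
split; rewrite /mink /origin /dir /=; first by ring.
by rewrite -!expr2 cos2Dsin2; ring.
Qed.

Let ray_cvg (a b : R) :
  proj (hline origin (0, (a, b)) t) @[t --> +oo] --> (a, b).
Proof.
(* The ratio is [tanh (t / 2)], rewritten so that its limit can be read off. *)
have E : (fun t => sinh t / (1 + cosh t) : R) =
    (fun t => (1 - expR (- t)) / (1 + expR (- t))).
  apply/funext => t; have e0 := expR_gt0 t.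
  rewrite /sinh /cosh expRN.
  by field; rewrite ?gt_eqF //; nra.
have c1 : sinh t / (1 + cosh t) @[t --> +oo] --> (1 : R).
  rewrite E -[X in _ --> X](_ : (1 - 0) / (1 + 0) = 1); last by rewrite subr0 addr0 divr1.
  apply: cvgM; first by apply: cvgB; [exact: cvg_cst|exact: cvgr_expR].
  apply: cvgV; first by rewrite addr0 oner_neq0.
  by apply: cvgD; [exact: cvg_cst|exact: cvgr_expR].
have k (c : R) : (cosh t * 0 + sinh t * c) / (1 + (cosh t * 1 + sinh t * 0)) @[t --> +oo] --> c.
  have cM : (sinh t / (1 + cosh t) * c) @[t --> +oo] --> c.
    by have := cvgM c1 (cvg_cst c); rewrite mul1r; exact. 
  apply: cvg_trans cM; apply: near_eq_cvg; apply: nearW => t.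
  by rewrite mulr0 add0r mulr0 addr0 mulr1 mulrAC.
exact: (cvg_pair (k a) (k b)).
Qed.

Lemma segmentE r theta z : segment r theta z <->
  exists2 s, 0 <= s <= r & z = proj (hline (1, (0, 0)) (0, (cos theta, sin theta)) s).
Proof.
split=> [[g [gg g0 gl [s /=]]]|[s s0r ->]].
  rewrite in_itv /= => /andP[s0 sr] <-; exists s; first by rewrite s0.
  have I0 : `[0 : R, +oo[%classic 0 by rewrite /= in_itv /= lexx.
  have I1 : `[0 : R, +oo[%classic 1 by rewrite /= in_itv /= ler01.
  have [V []] := geodesic_hlineE gg I0 I1 (oner_neq0 _).
  rewrite g0 lift0 => -[PV VV] gV.
  have {}gV t : 0 <= t -> g t = proj (hline (1, (0, 0)) V t).
    move=> t0; have It : `[0 : R, +oo[%classic t by rewrite /= in_itv /= t0.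
    by rewrite -gV // liftK //; case: gg => + _; exact.
  rewrite gV //; congr (proj (hline _ _ _)).
  case: V PV VV gV => v0 [v1 v2]; rewrite /mink /= => PV VV gV.
  have v00 : v0 = 0 by lra.
  rewrite v00 in gV *.
  (* A ray from the origin converges to the spatial part of its own tangent, so uniqueness of limits
     identifies the tangent with the direction [theta]. *)
  have : proj (hline origin (0, (v1, v2)) t) @[t --> +oo] --> (cos theta, sin theta).
    apply: cvg_trans gl; apply: near_eq_cvg.
    have : \forall t \near +oo%R, 0 <= t :> R by exact: nbhs_pinfty_ge.
    by apply: filterS => t t0; rewrite gV.
  have h2 := @ray_cvg v1 v2.
  by move=> /(cvg_unique (@norm_hausdorff _ (R * R)%type)) /(_ h2) [-> ->].
exists (fun t => proj (hline origin (dir theta) t)); split.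
- exact: geodesic_hline.
- by rewrite hline0 /proj /= !mul0r.
- exact: ray_cvg.
- by exists s => //=; rewrite in_itv.
Qed.

(** Tangency to the hyperboloid and Euclidean orthogonality in the disc are two linear relations
    between [v0] and [v1 * x.1 + v2 * x.2]. For [x] in the disc they force both to vanish, so the
    tangent is purely spatial and orthogonal to [x]. *)
Lemma perp_lineE x z : disc x -> perp_line x z <->
  exists a b t, [/\ a ^+ 2 + b ^+ 2 = 1, a * x.1 + b * x.2 = 0 &
    z = proj (hline (lift x) (0, (a, b)) t)].
Proof.
move=> dx; have fx := future_lift dx; have q1 := disc_gt0 dx.
split=> [[g [gg g0 _ gx [t _ <-]]]|[a [b [t [ab abx ->]]]]].
  have [V []] := geodesic_hlineE gg I I (oner_neq0 _).
  rewrite g0 => tV gV; have [PV VV] := tV.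
  have {}gV : g = (fun t => proj (hline (lift x) V (1 * t))).
    by apply/funext => u; rewrite mul1r -gV // liftK //; case: gg => + _; exact.
  move: gx; rewrite gV velocity_pline0 // /hmetric /= !mul1r => gx.
  have q0 := sqn_ge0 x.
  case: V tV PV VV gV gx => v0 [v1 v2] tV; rewrite /mink /=.
  set q := sqn x; have qE : q = x.1 ^+ 2 + x.2 ^+ 2 by [].
  move=> PV VV gV gx.
  have e1 : (1 + q) * v0 = 2 * (v1 * x.1 + v2 * x.2).
    apply: (mulIf (x := (1 - q)^-1)); first by rewrite invr_neq0 // gt_eqF.
    by rewrite mulrAC -[LHS]subr0 -{}PV; field; rewrite gt_eqF.
  have e2 : (v1 * x.1 + v2 * x.2) * (1 + (1 + q) / (1 - q)) = 2 * q / (1 - q) * v0.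
    move: gx; rewrite -qE.
    set p0 := (1 + q) / (1 - q).
    have p00 : 0 < 1 + p0.
      by rewrite addr_gt0 // divr_gt0 //; rewrite /q; lra.
    move=> gx.
    have : 4 / (1 - q) ^+ 2 / (1 + p0) ^+ 2 * ((v1 * x.1 + v2 * x.2) * (1 + p0) - 2 * q / (1 - q) * v0) = 0.
      by rewrite -[RHS]gx qE; field; rewrite -qE !gt_eqF.
    move/eqP; rewrite mulf_eq0 => /orP[|].
      rewrite mulf_eq0 invr_eq0 expf_eq0 /= (gt_eqF p00) orbF.
      by rewrite mulf_eq0 invr_eq0 expf_eq0 /= (gt_eqF q1) orbF pnatr_eq0.
    by rewrite subr_eq0 => /eqP.
  have e3 : (v1 * x.1 + v2 * x.2) = q * v0.
    have h : 1 + (1 + q) / (1 - q) = 2 / (1 - q) by field; rewrite gt_eqF.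
    move: e2; rewrite h => e2.
    apply: (mulIf (x := 2 / (1 - q))).
      by rewrite mulf_neq0 // invr_neq0 // gt_eqF.
    by rewrite e2; ring.
  have v00 : v0 = 0.
    apply: (mulfI (x := 1 - q)); first by rewrite gt_eqF.
    by move: e1; rewrite e3; lra.
  exists v1, v2, t; split; [by move: VV; rewrite v00; lra|by rewrite e3 v00 mulr0|].
  by rewrite v00.
have tV : unit_tangent (lift x) (0, (a, b)).
  split; rewrite /mink /=; last by lra.
  have -> : forall c : R, c * 0 - (2 * x.1 / (1 - sqn x) * a + 2 * x.2 / (1 - sqn x) * b)
     = - (2 / (1 - sqn x)) * (a * x.1 + b * x.2) by move=> c; ring.
  by rewrite abx mulr0.
have E : (fun u => proj (hline (lift x) (0, (a, b)) u)) =
  (fun u => proj (hline (lift x) (0, (a, b)) (1 * u))).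
  by apply/funext => u; rewrite mul1r.
exists (fun u => proj (hline (lift x) (0, (a, b)) u)); split.
- exact: geodesic_hline.
- by rewrite hline0 liftK.
- by rewrite E; have [+ _ _] := C1_pline 1 fx tV; apply.
- rewrite E velocity_pline0 // /hmetric /= !mulr0 !subr0 !mul1r.
  set k := (1 + (1 + sqn x) / (1 - sqn x)).
  have -> : a * k / k ^+ 2 * x.1 + b * k / k ^+ 2 * x.2 = k / k ^+ 2 * (a * x.1 + b * x.2).
    by ring.
  by rewrite abx !mulr0 mul0r.
- by exists t.
Qed.

End LinesAndSegments.

Section LinesHittingSegments.
Context {R : realType}.
Implicit Types (x z : R * R) (P V : R * (R * R)) (r s t theta : R).

Definition hitting r theta : set (R * R) :=
  [set x | disc x /\
     2 * sqn x * cosh r <=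
     sinh r * (cos theta * x.1 + sin theta * x.2) * (1 + sqn x)].

(** For [x != 0] the lifted line lies in the plane [(1 + |x|^2) (y . x) = 2 |x|^2 t], in coordinates
    [(t, y)]. The ray meets it at parameter [s] iff [sinh s * e * (1 + sqn x) = 2 * sqn x * cosh s].
    As [tanh] increases, a solution in [[0, r]] implies the inequality at [r]; the intermediate
    value theorem gives the converse. *)
Lemma hittingP r theta x : 0 <= r -> disc x ->
  segment r theta `&` perp_line x !=set0 <-> hitting r theta x.
Proof.
move=> r0 dx; have fx := future_lift dx; have q1 := disc_gt0 dx.
have q0 := sqn_ge0 x.
have fo : @future R (1, (0, 0)).
  by split; rewrite /mink /= ?ltr01 // !mul0r addr0 subr0 mulr1.
have to : unit_tangent (1, (0, 0)) (0, (cos theta, sin theta)).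
  split; rewrite /mink /=; first by ring.
  by rewrite -!expr2 cos2Dsin2; ring.
have e1 := cos2Dsin2 theta.
set e := cos theta * x.1 + sin theta * x.2.
have tx a b : a ^+ 2 + b ^+ 2 = 1 -> a * x.1 + b * x.2 = 0 ->
    unit_tangent (lift x) (0, (a, b)).
  move=> ab abx; split; rewrite /mink /=; last by lra.
  have -> : forall c : R, c * 0 - (2 * x.1 / (1 - sqn x) * a + 2 * x.2 / (1 - sqn x) * b)
     = - (2 / (1 - sqn x)) * (a * x.1 + b * x.2) by move=> c; ring.
  by rewrite abx mulr0.
split=> [[z [/segmentE[s /andP[s0 sr] ->]]]|[_]].
  move=> /(perp_lineE _ dx) [a [b [t [ab abx]]]] /(congr1 lift).
  rewrite !projK; [|exact: future_hline (tx _ _ ab abx)|exact: future_hline].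
  rewrite /hline /= => -[h0 h1 h2].
  split=> //; rewrite -/e.
  have E : sinh s * e * (1 + sqn x) = 2 * sqn x * cosh s.
    have -> : sinh s * e = cosh t * (2 * sqn x / (1 - sqn x)).
      transitivity ((cosh s * 0 + sinh s * cos theta) * x.1 +
         (cosh s * 0 + sinh s * sin theta) * x.2); first by rewrite /e; ring.
      rewrite h1 h2.
      transitivity (cosh t * (2 * (x.1 ^+ 2 + x.2 ^+ 2) / (1 - sqn x)) +
         sinh t * (a * x.1 + b * x.2)); first by ring.
      by rewrite abx mulr0 addr0.
    have -> : cosh s = cosh t * ((1 + sqn x) / (1 - sqn x)) by lra.
    by ring.
  have cs := cosh_gt0 s; have cr := cosh_gt0 r.
  (* This is [tanh s <= tanh r] with the denominators cleared. *)
  have : 0 <= sinh (r - s) by apply: sinh_ge0; lra.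
  have -> : sinh (r - s) = sinh r * cosh s - cosh r * sinh s.
    by rewrite /sinh /cosh opprB !expRD; field.
  rewrite subr_ge0 => mono.
  have : 0 <= e \/ (s = 0 /\ sqn x = 0).
    have := s0; rewrite le_eqVlt => /predU1P[s00|sp].
      right; split => //; move: E; rewrite -s00 sinh0 cosh0; lra.
    left; have ss := sinh_gt0 sp.
    have : 0 <= sinh s * (1 + sqn x) * e.
      have -> : sinh s * (1 + sqn x) * e = 2 * sqn x * cosh s by lra.
      by rewrite !mulr_ge0 // ltW.
    by rewrite pmulr_rge0 // mulr_gt0 //; lra.
  case=> [ee|[_ qq]]; last first.
    have : x.1 ^+ 2 + x.2 ^+ 2 = 0 by exact: qq.
    have := sqr_ge0 x.1; have := sqr_ge0 x.2 => ? ? ?.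
    have /eqP : x.1 ^+ 2 = 0 by lra.
    have /eqP : x.2 ^+ 2 = 0 by lra.
    rewrite !sqrf_eq0 => /eqP x2 /eqP x1.
    by rewrite /e x1 x2 qq !mulr0 addr0 !mulr0 !mul0r.
  rewrite -(ler_pM2r cs).
  have -> : 2 * sqn x * cosh r * cosh s = cosh r * (2 * sqn x * cosh s) by ring.
  rewrite -E.
  have -> : cosh r * (sinh s * e * (1 + sqn x)) = (cosh r * sinh s) * (e * (1 + sqn x)) by ring.
  have -> : sinh r * e * (1 + sqn x) * cosh s = (sinh r * cosh s) * (e * (1 + sqn x)) by ring.
  by apply: ler_wpM2r => //; rewrite mulr_ge0 //; lra.
rewrite -/e => H.
pose f s := sinh s * (e * (1 + sqn x)) - 2 * sqn x * cosh s.
have cf : {within `[0, r], continuous f}.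
  apply: continuous_at_within => u _.
  exact: continuousPB
    (continuousPM (@continuous_sinh R u) (continuousPc (e * (1 + sqn x)) u))
    (continuousPM (continuousPc (2 * sqn x) u) (@continuous_cosh R u)).
have f0 : f 0 <= 0 by rewrite /f sinh0 cosh0 mul0r; lra.
have fr : 0 <= f r by rewrite /f; lra.
have [|s] := IVT (v := 0) r0 cf.
  by rewrite ge_min f0 le_max fr orbT.
rewrite in_itv /= => /andP[s0 sr] /eqP; rewrite subr_eq0 => /eqP E.
exists (proj (hline (1, (0, 0)) (0, (cos theta, sin theta)) s)); split.
  by apply/segmentE; exists s; rewrite ?s0.
apply/(perp_lineE _ dx).
have [q00|qp] := eqVneq (sqn x) 0.
  have : x.1 ^+ 2 + x.2 ^+ 2 = 0 by exact: q00.
  have := sqr_ge0 x.1; have := sqr_ge0 x.2 => ? ? ?.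
  have /eqP : x.1 ^+ 2 = 0 by lra.
  have /eqP : x.2 ^+ 2 = 0 by lra.
  rewrite !sqrf_eq0 => /eqP x2 /eqP x1.
  (* At the degenerate point every direction is orthogonal to [x], so the line in direction [theta]
     itself is available. *)
  exists (cos theta), (sin theta), s; split => //.
    by rewrite x1 x2 !mulr0 addr0.
  by congr (proj (hline _ _ _)); rewrite /lift x1 x2 q00 addr0 subr0 divr1 mulr0 mul0r.
have {}qp : 0 < sqn x by rewrite lt0r qp.
pose k := Num.sqrt (sqn x).
have k2 : k ^+ 2 = sqn x by rewrite sqr_sqrtr.
have k0 : 0 < k by rewrite sqrtr_gt0.
pose a := - x.2 / k; pose b := x.1 / k.
have ab : a ^+ 2 + b ^+ 2 = 1.
  have -> : a ^+ 2 + b ^+ 2 = sqn x / k ^+ 2.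
    by rewrite /a /b /sqn; field; rewrite gt_eqF.
  by rewrite k2 divff // gt_eqF.
have abx : a * x.1 + b * x.2 = 0 by rewrite /a /b; ring.
pose j := cos theta * a + sin theta * b.
(* Forced by the component along [(a, b)], which is [sinh t] on the line and [sinh s * j] on the
   ray. The time component and the component along [x] remain to be compared. *)
pose t := arsinh (sinh s * j).
have sht : sinh t = sinh s * j by exact: arsinhK.
exists a, b, t; split => //.
have jq : j ^+ 2 * sqn x = sqn x - e ^+ 2.
  have -> : j ^+ 2 * sqn x = (sin theta * x.1 - cos theta * x.2) ^+ 2.
    rewrite -k2 /j /a /b; field; by rewrite gt_eqF.
  have -> : sqn x - e ^+ 2 = sqn x * (cos theta ^+ 2 + sin theta ^+ 2) - e ^+ 2.
    by rewrite e1 mulr1.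
  by rewrite /e /sqn; ring.
have cht : cosh t * (1 + sqn x) = cosh s * (1 - sqn x).
  have cs := cosh_gt0 s; have ct := cosh_gt0 t.
  apply/eqP; rewrite -(eqrXn2 (n := 2)) //; try by rewrite mulr_ge0 //; lra.
  apply/eqP.
  apply: (mulIf (x := sqn x)); first by rewrite gt_eqF.
  have h1 := cosh2_sinh2 s.
  have h2 : sinh s ^+ 2 * e ^+ 2 * (1 + sqn x) ^+ 2 = 4 * sqn x ^+ 2 * cosh s ^+ 2.
    transitivity ((sinh s * (e * (1 + sqn x))) ^+ 2); first by ring.
    by rewrite E; ring.
  transitivity ((1 + sinh t ^+ 2) * (1 + sqn x) ^+ 2 * sqn x).
    by rewrite -cosh2_sinh2; ring.
  rewrite sht.
  transitivity (sqn x * (1 + sqn x) ^+ 2 + sinh s ^+ 2 * (j ^+ 2 * sqn x) * (1 + sqn x) ^+ 2).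
    by ring.
  rewrite jq.
  transitivity ((1 + sinh s ^+ 2) * sqn x * (1 + sqn x) ^+ 2 - sinh s ^+ 2 * e ^+ 2 * (1 + sqn x) ^+ 2).
    by ring.
  by rewrite -h1 h2; ring.
have cht' : cosh t = cosh s * (1 - sqn x) / (1 + sqn x).
  by rewrite -cht mulfK // gt_eqF //; lra.
congr proj; rewrite /hline /= sht cht'.
have ee : sinh s * e = 2 * sqn x * cosh s / (1 + sqn x).
  by rewrite -E; field; rewrite gt_eqF //; lra.
have kk : k ^+ 2 = x.1 ^+ 2 + x.2 ^+ 2 by exact: k2.
have dec1 : cos theta * sqn x = e * x.1 + (j * a) * sqn x.
  have -> : j * a * sqn x = cos theta * x.2 ^+ 2 - sin theta * x.1 * x.2.
    by rewrite -k2 /j /a /b; field; rewrite gt_eqF.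
  by rewrite /e /sqn; ring.
have dec2 : sin theta * sqn x = e * x.2 + (j * b) * sqn x.
  have -> : j * b * sqn x = sin theta * x.1 ^+ 2 - cos theta * x.1 * x.2.
    by rewrite -k2 /j /a /b; field; rewrite gt_eqF.
  by rewrite /e /sqn; ring.
congr (_, (_, _)).
- by field; rewrite !gt_eqF //; lra.
- apply: (mulIf (x := sqn x)); first by rewrite gt_eqF.
  transitivity (sinh s * (cos theta * sqn x)); first by ring.
  rewrite dec1 mulrDr mulrA ee.
  by field; rewrite !gt_eqF //; lra.
- apply: (mulIf (x := sqn x)); first by rewrite gt_eqF.
  transitivity (sinh s * (sin theta * sqn x)); first by ring.
  rewrite dec2 mulrDr mulrA ee.
  by field; rewrite !gt_eqF //; lra.
Qed.

End LinesHittingSegments.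

(** * Intensity of the lines hitting a segment *)

Section Intensity.
Context {R : realType}.
Implicit Types (lambda r m rho phi : R) (A B : set (R * R)).

Let density lambda rho : R := 2 * lambda * ((1 + rho ^+ 2) / (1 - rho ^+ 2) ^+ 2).

Let density_ge0 lambda rho : 0 <= lambda -> 0 <= density lambda rho.
Proof.
move=> l0; rewrite /density mulr_ge0 ?mulr_ge0 // ?invr_ge0 ?sqr_ge0 //.
by rewrite addr_ge0 ?sqr_ge0.
Qed.

Let continuous_density lambda rho : 0 <= rho < 1 ->
  {for rho, continuous (density lambda)}.
Proof.
move=> rho1.
have k : {for rho, continuous (fun u : R => u ^+ 2)} by exact: exprn_continuous.
apply: (continuousPM (continuousPc (2 * lambda) rho)).
apply: (continuousPM (continuousPD (continuousPc 1 rho) k)).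
apply: continuousPV; last first.
  exact: continuousPX (continuousPB (continuousPc 1 rho) k).
by rewrite expf_neq0 // gt_eqF //; nra.
Qed.

Lemma measurable_polar : measurable_fun setT (@polar R).
Proof.
apply: measurable_fun_pair; apply: measurable_funM => //=.
  apply: (measurableT_comp (f := @cos R)) => //.
  by apply: continuous_measurable_fun; exact: continuous_cos.
apply: (measurableT_comp (f := @sin R)) => //.
by apply: continuous_measurable_fun; exact: continuous_sin.
Qed.

Let pdom : set (R * R) := `]0, 1[ `*` `[0, (2 * pi)[.

Let measurable_pdom A : measurable A -> measurable (pdom `&` (@polar R @^-1` A)).
Proof.
move=> mA; apply: measurableI.
  by apply: measurableX; exact: measurable_itv.
by rewrite -[X in measurable X]setTI; exact: measurable_polar.
Qed.

Let measurable_density lambda A : measurable A ->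
  measurable_fun (pdom `&` (@polar R @^-1` A)) (fun p => (density lambda p.1)%:E).
Proof.
move=> mA; apply/measurable_EFinP.
have mf : measurable_fun (`]0, 1[%classic : set R) (density lambda).
  apply: open_continuous_measurable_fun; first exact: interval_open.
  move=> x; rewrite inE /= in_itv /= => /andP[x0 x1].
  by apply: continuous_density; rewrite x1 ltW.
apply: (measurable_comp _ _ mf) => //.
  by move=> _ [p [[p1 _] _] <-].
exact: (@measurable_funS _ _ _ _ setT).
Qed.

Lemma line_intensityU lambda A B : 0 <= lambda -> measurable A -> measurable B ->
  [disjoint A & B] ->
  line_intensity lambda (A `|` B) = (line_intensity lambda A + line_intensity lambda B)%E.
Proof.
move=> l0 mA mB AB; rewrite /line_intensity preimage_setU setIUr.
rewrite ge0_integral_setU //.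
- exact: measurable_pdom.
- exact: measurable_pdom.
- by rewrite -setIUr -preimage_setU; apply: measurable_density; exact: measurableU.
- by move=> p _; rewrite lee_fin density_ge0.
- apply/disj_setPS => p [[_ Ap] [_ Bp]].
  by move/disj_setPS : AB => /(_ (polar p)); apply.
Qed.

Lemma line_intensityS lambda A B : 0 <= lambda -> measurable A -> measurable B ->
  A `<=` B -> (line_intensity lambda A <= line_intensity lambda B)%E.
Proof.
move=> l0 mA mB AB; apply: ge0_subset_integral.
- exact: measurable_pdom.
- exact: measurable_pdom.
- exact: measurable_density.
- by move=> p _; rewrite lee_fin density_ge0.
- by move=> p [pd Ap]; split => //; exact: AB.
Qed.

Lemma line_intensity_ge0 lambda A : 0 <= lambda -> (0 <= line_intensity lambda A)%E.
Proof.
by move=> l0; apply: integral_ge0 => p _; rewrite lee_fin density_ge0.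
Qed.

Lemma line_intensityE lambda A : 0 <= lambda -> measurable A ->
  line_intensity lambda A =
  (\int[lebesgue_measure]_(phi in `[0%R, (2 * pi)%R[)
     \int[lebesgue_measure]_(rho in `]0%R, 1%R[ `&` [set rho | A (polar (rho, phi))])
       (2 * lambda * ((1 + rho ^+ 2) / (1 - rho ^+ 2) ^+ 2))%:E)%E.
Proof.
move=> l0 mA; rewrite /line_intensity integral_mkcond.
rewrite fubini_tonelli2; last 2 first.
- apply/(measurable_restrictT _ (measurable_pdom mA)).
  exact: measurable_density.
- move=> p; rewrite patchE; case: ifP => // _.
  by rewrite lee_fin density_ge0.
rewrite [RHS]integral_mkcond; apply: eq_integral => phi _.
rewrite /fubini_G [RHS]patchE; case: ifPn => [|] /=; last first.
  move=> /negP phi0; apply: integral0_eq => rho _.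
  rewrite patchE; case: ifPn => // /set_mem [[_ /= h] _].
  by exfalso; apply: phi0; rewrite inE.
rewrite inE => phi0; rewrite [RHS]integral_mkcond; apply: eq_integral => rho _.
rewrite !patchE; congr (if _ then _ else _).
by apply/idP/idP; rewrite !inE; [move=> [[? _] ?]|move=> [? ?]].
Qed.

(* With [T = sinh r], the radial coordinate [rho] of a line with direction
   [phi] at angular distance [arccos m] from [theta] that hits the segment
   ranges over [0 < rho <= T m / (cosh r + sqrt (1 + T^2 (1 - m^2)))]. *)
Lemma radial_integral lambda r m : 0 < r -> m <= 1 ->
  (\int[lebesgue_measure]_(rho in `]0%R, 1%R[ `&`
       [set rho | (2 * rho * cosh r <= sinh r * m * (1 + rho ^+ 2))%R])
     (2 * lambda * ((1 + rho ^+ 2) / (1 - rho ^+ 2) ^+ 2))%:E)%E =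
  (lambda * (sinh r * Num.max m 0 / Num.sqrt (1 + sinh r ^+ 2 * (1 - m ^+ 2))))%:E.
Proof.
move=> r0 m1; have T0 := sinh_gt0 r0; have C0 := cosh_gt0 r.
have CT := cosh2_sinh2 r.
have [m0|m0] := leP m 0.
  rewrite mulr0 mul0r mulr0; set D := (X in integral _ X _).
  have -> : D = set0; last by rewrite integral_set0.
  apply/seteqP; split => // rho [] /=; rewrite in_itv /= => /andP[p0 p1].
  apply/negP; rewrite -ltNge; apply: (@le_lt_trans _ _ 0).
    rewrite mulr_le0_ge0 ?addr_ge0 ?sqr_ge0 // mulr_ge0_le0 //; exact: ltW.
  by apply: mulr_gt0 => //; apply: mulr_gt0.
set T := sinh r in T0 CT *; set C := cosh r in C0 CT *.
have CT1 : T < C by nra.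
set w := Num.sqrt _.
have h0 : 0 < 1 + T ^+ 2 * (1 - m ^+ 2).
  by rewrite ltr_wpDr // mulr_ge0 ?sqr_ge0 //; nra.
have w0 : 0 < w by rewrite sqrtr_gt0.
have w2 : w ^+ 2 = C ^+ 2 - (T * m) ^+ 2 by rewrite sqr_sqrtr ?ltW // CT; ring.
set b := T * m / (C + w).
have Cw : 0 < C + w by rewrite addr_gt0.
have b0 : 0 < b by rewrite divr_gt0 // mulr_gt0.
have Tm : T * m <= T by nra.
have b1 : b < 1 by rewrite ltr_pdivrMr // mul1r; lra.
have bE : 1 - b ^+ 2 = 2 * w / (C + w).
  have -> : 1 - b ^+ 2 = ((C + w) ^+ 2 - (T * m) ^+ 2) / (C + w) ^+ 2.
    by rewrite /b; field; rewrite gt_eqF.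
  have -> : (C + w) ^+ 2 - (T * m) ^+ 2 = 2 * w * (C + w) by lra.
  by field; rewrite gt_eqF.
have -> : `]0%R, 1%R[ `&` [set rho | 2 * rho * C <= T * m * (1 + rho ^+ 2)] =
    `]0, b]%classic.
  (* The quadratic has the reciprocal roots [b < 1] and [1 / b]; the factor carrying the second root
     is positive on the unit interval. *)
  have key (rho : R) : T * m * (1 + rho ^+ 2) - 2 * rho * C =
      (b - rho) * ((C + w) - T * m * rho).
    have h : T * m * b = C - w.
      have -> : T * m * b = (T * m) ^+ 2 / (C + w) by rewrite /b; ring.
      have -> : (T * m) ^+ 2 = (C - w) * (C + w) by lra.
      by rewrite mulfK // gt_eqF.
    have h' : b * (C + w) = T * m by rewrite divfK // gt_eqF.
    transitivity (b * (C + w) - T * m * b * rho - rho * (C + w) + T * m * rho ^+ 2).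
      by rewrite h h'; ring.
    by ring.
  have pos (rho : R) : 0 < rho < 1 -> 0 < C + w - T * m * rho.
    move=> /andP[p0 p1]; have := mulr_gt0 T0 m0 => tm.
    have : T * m * rho < T * m * 1 by rewrite ltr_pM2l.
    by lra.
  apply/seteqP; split => rho /=; rewrite !in_itv /=.
    move=> [p01]; rewrite -subr_ge0 key pmulr_lge0 ?pos // subr_ge0 => ->.
    by case/andP: p01 => ->.
  move=> /andP[p0 pb]; have p01 : 0 < rho < 1 by rewrite p0 (le_lt_trans pb).
  by split => //; rewrite -subr_ge0 key pmulr_lge0 ?pos // subr_ge0.
rewrite integral_itv_obnd_cbnd; last first.
  apply/measurable_EFinP/measurable_fun_itv_obnd_cbndP.
  apply: subspace_continuous_measurable_fun; first exact: measurable_itv.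
  apply: continuous_at_within => x /andP[x0 xb].
  by apply: continuous_density; rewrite x0 (le_lt_trans xb).
(* The antiderivative [2 u / (1 - u^2)] is [sinh] of the hyperbolic distance from the origin to a
   point at Euclidean distance [u]: in hyperbolic polar coordinates the density is [lambda * cosh],
   that of the invariant measure on lines. *)
have dF x : 0 <= x <= b ->
    is_derive x 1 (fun u => lambda * (2 * u / (1 - u ^+ 2))) (density lambda x).
  move=> /andP[x0 xb]; have x1 : x ^+ 2 < 1 by nra.
  have d1 : is_derive x 1 (fun u : R => 2 * u) (2 * 1).
    exact: is_derivePZ (is_derive_id x 1).
  have d2 : is_derive x 1 (fun u : R => 1 - u ^+ 2) (0 - 2 * x * 1).
    exact: is_derivePB (is_derivePc 1 x) (is_deriveP_sqr (is_derive_id x 1)).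
  have n0 : 1 - x ^+ 2 != 0 by rewrite gt_eqF // subr_gt0.
  have := is_derivePZ lambda (is_derivePdiv (g := fun u => 1 - u ^+ 2) n0 d1 d2) => /is_derive_eq; apply.
  by rewrite /density; field.
rewrite (FTC_closed b0 dF) => [|x /andP[x0 xb]].
  rewrite !mulr0 mul0r mulr0 subr0 bE; congr (_ %:E); congr (_ * _).
  by rewrite /b; field; rewrite !gt_eqF.
by apply: continuous_density; rewrite x0 (le_lt_trans xb).
Qed.

End Intensity.

(** * Integrals of periodic functions over a shifted period *)

Section PeriodicIntegral.
Context {R : realType}.
Implicit Types (f : R -> R) (a b c : R).

Lemma continuousPmax f g (x : R) : {for x, continuous f} -> {for x, continuous g} ->
  {for x, continuous (fun t => Num.max (f t) (g t))}.
Proof.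
move=> cf cg.
have -> : (fun t => Num.max (f t) (g t)) = (fun t => (f t + g t + `|f t - g t|) / 2).
  by apply/funext => t; rewrite maxr_absE.
have cn : {for x, continuous (fun t => `|f t - g t|)}.
  exact: (continuous_comp (continuousPB cf cg) (@norm_continuous _ R^o _)).
exact: continuousPM (continuousPD (continuousPD cf cg) cn) (continuousPc 2^-1 x).
Qed.

Lemma ge0_integral_itv_split f a b c : a <= b -> b <= c -> continuous f ->
  (forall x, 0 <= f x) ->
  (\int[lebesgue_measure]_(x in `[a, c]) (f x)%:E =
   \int[lebesgue_measure]_(x in `[a, b]) (f x)%:E +
   \int[lebesgue_measure]_(x in `[b, c]) (f x)%:E)%E.
Proof.
move=> ab bc cf f0.
have mf (A : set R) : measurable_fun A (fun x => (f x)%:E).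
  apply/measurable_EFinP; apply: measurable_funTS.
  exact: continuous_measurable_fun.
have -> : `[a, c]%classic = `[a, b]%classic `|` `]b, c]%classic.
  by rewrite -itv_bndbnd_setU // bnd_simp.
rewrite ge0_integral_setU //.
- by rewrite integral_itv_obnd_cbnd.
- exact: mf.
- by move=> x _; rewrite lee_fin.
- apply/disj_setPS => x [] /=; rewrite !in_itv /= => /andP[_ xb] /andP[bx _].
  by rewrite ltNge xb in bx.
Qed.

Lemma integral_itv_shift f a b c : a <= b -> continuous f ->
  (\int[lebesgue_measure]_(x in `[(a + c)%R, (b + c)%R]) (f x)%:E =
   \int[lebesgue_measure]_(x in `[a, b]) (f (x + c))%:E)%E.
Proof.
move=> ab cf.
have d1 (x : R) : is_derive x 1 (fun x : R => x + c) (1 + 0).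
  exact: is_derivePD (is_derive_id x 1) (is_derivePc c x).
have D1 : derive1 (fun x : R => x + c) = cst 1.
  by apply/funext => x; rewrite derive1E; have [_ ->] := d1 x; rewrite addr0.
have cD (x : R) : {for x, continuous (fun x : R => x + c)}.
  exact: is_derive_continuous (d1 x).
rewrite (integration_by_substitution_increasing (F := fun x => x + c)) //.
- by apply: eq_integral => x _; rewrite D1 /= mulr1.
- by move=> x y _ _; rewrite ltrD2r.
- by rewrite D1 => x _; exact: cst_continuous.
- by rewrite D1; exact: is_cvg_cst.
- by rewrite D1; exact: is_cvg_cst.
- split; first by move=> x _; have [] := d1 x.
    by apply: cvg_at_right_filter; exact: cD.
  by apply: cvg_at_left_filter; exact: cD.
- by apply: continuous_subspaceT.
Qed.

(** The part over [[0, a]] moves by one period to [[p, a + p]]. This lets the angular integral start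
    at an angle from which the maximum of two cosines has simple pieces. *)
Lemma integral_periodic f a p : 0 <= a <= p -> continuous f ->
  (forall x, 0 <= f x) -> (forall x, f (x + p) = f x) ->
  (\int[lebesgue_measure]_(x in `[0%R, p[) (f x)%:E =
   \int[lebesgue_measure]_(x in `[a, (a + p)%R]) (f x)%:E)%E.
Proof.
move=> /andP[a0 ap] cf f0 fp.
rewrite integral_itv_bndo_bndc; last first.
  apply/measurable_EFinP; apply: measurable_funTS.
  exact: continuous_measurable_fun.
have pap : p <= a + p by rewrite lerDr.
rewrite (ge0_integral_itv_split a0 ap cf f0) (ge0_integral_itv_split ap pap cf f0).
rewrite addeC; congr (_ + _)%E.
have := integral_itv_shift p a0 cf; rewrite add0r => ->.
by apply: eq_integral => x _; rewrite fp.
Qed.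

End PeriodicIntegral.

(** * The angular integral and the Crofton formula *)

Section IntensityOfHittingLines.
Context {R : realType}.
Implicit Types (lambda r m rho phi theta : R).

Lemma is_derive_arsinh (y : R) : is_derive y 1 arsinh (Num.sqrt (1 + y ^+ 2))^-1.
Proof.
have y0 := arsinh_arg_gt0 y.
have q0 : 0 < 1 + y ^+ 2 by rewrite ltr_wpDr ?sqr_ge0.
have s0 : 0 < Num.sqrt (1 + y ^+ 2) by rewrite sqrtr_gt0.
have d1 : is_derive y 1 (fun y : R => 1 + y ^+ 2) (0 + 2 * y * 1).
  exact: is_derivePD (is_derivePc 1 y) (is_deriveP_sqr (is_derive_id y 1)).
have d2 := is_derivePD (is_derive_id y 1)
  (is_deriveP_comp (g := fun y => 1 + y ^+ 2) (is_derive1_sqrt q0) d1).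
have := is_deriveP_comp (f := @ln R) (g := fun t => t + Num.sqrt (1 + t ^+ 2))
  (is_derive1_ln y0) d2.
move=> /is_derive_eq; apply.
by field; rewrite !gt_eqF.
Qed.

Lemma arsinhN (y : R) : arsinh (- y) = - arsinh y.
Proof.
rewrite /arsinh sqrrN; have y0 := arsinh_arg_gt0 y.
have q2 : Num.sqrt (1 + y ^+ 2) ^+ 2 = 1 + y ^+ 2.
  by rewrite sqr_sqrtr // addr_ge0 ?sqr_ge0.
have -> : - y + Num.sqrt (1 + y ^+ 2) = (y + Num.sqrt (1 + y ^+ 2))^-1.
  by apply: (mulfI (lt0r_neq0 y0)); rewrite mulfV ?lt0r_neq0 //; lra.
by rewrite lnV.
Qed.

Lemma arsinh_sinh r : arsinh (sinh r) = r.
Proof.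
rewrite /arsinh -cosh2_sinh2 sqrtr_sqr ger0_norm ?ltW ?cosh_gt0 //.
by rewrite addrC coshD_sinh expRK.
Qed.

Lemma measurable_sqn : measurable_fun setT (@sqn R).
Proof. by apply: measurable_funD; apply: measurable_funX. Qed.

Lemma measurable_disc : measurable (@disc R).
Proof.
have -> : @disc R = (@sqn R) @^-1` `]-oo, 1[.
  by apply/seteqP; split => x /=; rewrite in_itv.
by rewrite -[X in measurable X]setTI; apply: measurable_sqn.
Qed.

Lemma measurable_hitting r theta : measurable (hitting r theta).
Proof.
pose f (x : R * R) := sinh r * (cos theta * x.1 + sin theta * x.2) * (1 + sqn x) -
  2 * sqn x * cosh r.
have mf : measurable_fun setT f.
  apply: measurable_funB.
    apply: measurable_funM; last exact: measurable_funD measurable_sqn.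
    apply: measurable_funM => //.
    by apply: measurable_funD; apply: measurable_funM.
  by apply: measurable_funM => //; apply: measurable_funM => //; exact: measurable_sqn.
have -> : hitting r theta = @disc R `&` f @^-1` `[0, +oo[.
  by apply/seteqP; split => x [dx /=]; rewrite in_itv /= andbT subr_ge0.
apply: measurableI; first exact: measurable_disc.
by rewrite -[X in measurable X]setTI; apply: mf.
Qed.

Lemma hitting_polar r theta rho phi : 0 < rho < 1 ->
  hitting r theta (polar (rho, phi)) <->
  2 * rho * cosh r <= sinh r * cos (phi - theta) * (1 + rho ^+ 2).
Proof.
move=> /andP[p0 p1].
have e : sqn (polar (rho, phi)) = rho ^+ 2.
  rewrite /sqn /polar /= !exprMn -mulrDr cos2Dsin2 mulr1 //.
have eq : cos theta * (rho * cos phi) + sin theta * (rho * sin phi) = rho * cos (phi - theta).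
  by rewrite cosB; ring.
have -> : hitting r theta (polar (rho, phi)) <->
    2 * rho ^+ 2 * cosh r <= sinh r * (rho * cos (phi - theta)) * (1 + rho ^+ 2).
  rewrite /hitting /= -eq e; split => [[]//|h]; split => //.
  by rewrite /disc /= -/(sqn (polar (rho, phi))) e; nra.
have -> : 2 * rho ^+ 2 * cosh r = rho * (2 * rho * cosh r) by ring.
have -> : sinh r * (rho * cos (phi - theta)) * (1 + rho ^+ 2) =
  rho * (sinh r * cos (phi - theta) * (1 + rho ^+ 2)) by ring.
by rewrite ler_pM2l.
Qed.

(** The radial condition is monotone in the cosine, so a union of two sets amounts to the larger of
    two cosines. Over the period starting at [theta1 - pi / 2], that is first [cos (phi - theta1)],
    from the bisector on [cos (phi - theta2)], and past [theta2 + pi / 2] both are nonpositive. The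
    bound [pi / 2 <= theta1] keeps the start of the period nonnegative; equal angles give the value
    [2 * lambda * r] of one segment. *)
Lemma hittingU_intensity lambda r theta1 theta2 : 0 < lambda -> 0 < r ->
  pi / 2 <= theta1 <= pi / 2 + 2 * pi -> theta1 <= theta2 <= theta1 + pi / 2 ->
  line_intensity lambda (hitting r theta1 `|` hitting r theta2) =
  (2 * lambda * (r + arsinh (sinh r * sin ((theta2 - theta1) / 2))))%:E.
Proof.
move=> l0 r0 /andP[t1a t1b] /andP[t12 t2].
have T0 := sinh_gt0 r0; set T := sinh r in T0 *.
have pi0 := @pi_gt0 R.
pose M phi := Num.max (cos (phi - theta1)) (cos (phi - theta2)).
pose h m : R := lambda * (T * Num.max m 0 / Num.sqrt (1 + T ^+ 2 * (1 - m ^+ 2))).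
have M1 phi : `|M phi| <= 1.
  by rewrite /M; have [_|_] := leP (cos (phi - theta1)) (cos (phi - theta2)); exact: cos_max.
have rad_gt0 m : `|m| <= 1 -> 0 < 1 + T ^+ 2 * (1 - m ^+ 2).
  move=> m1; rewrite ltr_wpDr // mulr_ge0 ?sqr_ge0 // subr_ge0.
  by rewrite -real_normK ?num_real // expr_le1.
have h0 m : 0 <= h m.
  by rewrite /h mulr_ge0 ?(ltW l0) // divr_ge0 ?sqrtr_ge0 // mulr_ge0 ?(ltW T0) // le_max lexx orbT.
have cM phi : {for phi, continuous M}.
  have cc theta : {for phi, continuous (fun u : R => cos (u - theta))}.
    apply: (continuous_comp (continuousPB _ (continuousPc theta phi))).
      exact: cvg_id.
    exact: continuous_cos.
  exact: continuousPmax (cc theta1) (cc theta2).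
have chM : continuous (h \o M).
  move=> phi; suff : {for phi, continuous (h \o M)} by [].
  apply: (continuousPM (continuousPc lambda phi)).
  apply: continuousPM.
    exact: continuousPM (continuousPc T phi) (continuousPmax (cM phi) (continuousPc 0 phi)).
  apply: continuousPV; first by rewrite sqrtr_eq0 -ltNge rad_gt0.
  apply: continuousPsqrt; apply: (continuousPD (continuousPc 1 phi)).
  apply: (continuousPM (continuousPc (T ^+ 2) phi)).
  exact: continuousPB (continuousPc 1 phi) (continuousPX (cM phi)).
have perM phi : (h \o M) (phi + 2 * pi) = (h \o M) phi.
  rewrite /= /M; congr (h (Num.max _ _));
    by rewrite addrAC mulrC mulr_natr cosD2pi.
have -> : line_intensity lambda (hitting r theta1 `|` hitting r theta2) =
   (\int[lebesgue_measure]_(phi in `[0%R, (2 * pi)%R[) ((h \o M) phi)%:E)%E.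
  rewrite line_intensityE ?ltW //; last first.
    by apply: measurableU; exact: measurable_hitting.
  apply: eq_integral => phi _.
  rewrite -radial_integral //; last first.
    by apply: le_trans (M1 phi); exact: ler_norm.
  congr (integral _ _ _); apply/seteqP; split => rho [p01] /= hp; split => //.
    have := p01; rewrite /= in_itv /= => p01'.
    have TM m : m <= M phi -> 2 * rho * cosh r <= sinh r * m * (1 + rho ^+ 2) ->
        2 * rho * cosh r <= sinh r * M phi * (1 + rho ^+ 2).
      move=> mM /le_trans; apply; apply: ler_wpM2r; first by rewrite addr_ge0 ?sqr_ge0.
      by rewrite ler_pM2l.
    by case: hp => /hitting_polar -/(_ p01') /TM; apply; rewrite le_max lexx ?orbT.
  have := p01; rewrite /= in_itv /= => p01'.
  move: hp; rewrite /M.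
  by have [_|_] := leP (cos (phi - theta1)) (cos (phi - theta2)) => hp;
    [right|left]; exact/hitting_polar.
pose a := theta1 - pi / 2; pose mid := (theta1 + theta2) / 2.
have aE : a = theta1 - pi / 2 by []. have midE : mid = (theta1 + theta2) / 2 by [].
have a02 : 0 <= a <= 2 * pi by apply/andP; split; lra.
have am : a <= mid by lra.
have mb : mid <= theta2 + pi / 2 by lra.
have bc : theta2 + pi / 2 <= a + 2 * pi by lra.
have hM0 phi : 0 <= (h \o M) phi by exact: h0.
rewrite (integral_periodic a02 chM hM0 perM).
rewrite (ge0_integral_itv_split am (le_trans mb bc) chM hM0).
rewrite (ge0_integral_itv_split mb bc chM hM0).
have diffcos phi : cos (phi - theta1) - cos (phi - theta2) =
    2 * sin (mid - phi) * sin ((theta2 - theta1) / 2).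
  have -> : phi - theta1 = (theta2 - theta1) / 2 - (mid - phi) by rewrite midE; lra.
  have -> : phi - theta2 = - ((theta2 - theta1) / 2 + (mid - phi)) by rewrite midE; lra.
  rewrite cosN; move: ((theta2 - theta1) / 2) (mid - phi) => u v.
  by rewrite cosB cosD; ring.
have sa0 : 0 <= sin ((theta2 - theta1) / 2) by apply: sin_ge0_pi; apply/andP; split; lra.
(* Where a single cosine is the maximum, [1 + T^2 (1 - cos^2) = 1 + T^2 sin^2] makes the integrand
   the derivative of [lambda * arsinh (T * sin (x - theta))]. *)
have piece theta u v : u < v -> (forall phi, u <= phi <= v -> M phi = cos (phi - theta)) ->
    theta - pi / 2 <= u -> v <= theta + pi / 2 ->
    (\int[lebesgue_measure]_(x in `[u, v]) ((h \o M) x)%:E =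
      (lambda * (arsinh (T * sin (v - theta)) - arsinh (T * sin (u - theta))))%:E)%E.
  move=> uv ME tu vt.
  have dF x : u <= x <= v -> is_derive x 1
      (fun x => lambda * arsinh (T * sin (x - theta))) ((h \o M) x).
    move=> xuv; have /andP[ux xv] := xuv.
    have d1 : is_derive x 1 (fun x : R => x - theta) (1 - 0).
      exact: is_derivePB (is_derive_id x 1) (is_derivePc theta x).
    have d2 := is_deriveP_comp (g := fun x => x - theta) (is_derive_sin (x - theta)) d1.
    have d3 := is_deriveP_comp (g := fun x => T * sin (x - theta))
      (is_derive_arsinh _) (is_derivePZ T d2).
    have := is_derivePZ lambda d3 => /is_derive_eq; apply.
    rewrite /= /h ME // subr0 mulr1.
    have -> : Num.max (cos (x - theta)) 0 = cos (x - theta).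
      by apply/max_idPl; apply: cos_ge0_pihalf; apply/andP; split; lra.
    have -> : 1 + T ^+ 2 * (1 - cos (x - theta) ^+ 2) = 1 + (T * sin (x - theta)) ^+ 2.
      by rewrite -sin2cos2; ring.
    by ring.
  rewrite (FTC_closed uv dF) ?mulrBr // => x _.
  exact: chM.
have max1 phi : a <= phi <= mid -> M phi = cos (phi - theta1).
  move=> /andP[p1 p2]; apply/max_idPl; rewrite -subr_ge0 diffcos.
  by rewrite !mulr_ge0 //; apply: sin_ge0_pi; apply/andP; split; lra.
have max2 phi : mid <= phi <= theta2 + pi / 2 -> M phi = cos (phi - theta2).
  move=> /andP[p1 p2]; apply/max_idPr; rewrite -subr_le0 diffcos.
  have : 0 <= sin (phi - mid) by apply: sin_ge0_pi; apply/andP; split; lra.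
  by rewrite -opprB sinN => s0; rewrite mulr_le0_ge0 // mulr_ge0_le0 //; lra.
have am' : a < mid by lra.
have mb' : mid < theta2 + pi / 2 by lra.
rewrite (piece theta1 a mid am' max1); [|lra|lra].
rewrite (piece theta2 _ _ mb' max2); [|lra|lra].
rewrite integral0_eq ?adde0; last first.
  move=> phi /=; rewrite in_itv /= => /andP[p1 p2]; rewrite /h.
  have -> : Num.max (M phi) 0 = 0; last by rewrite mulr0 mul0r mulr0.
  apply/max_idPr; rewrite /M ge_max; apply/andP; split.
    have -> : cos (phi - theta1) = - cos (phi - theta1 - pi).
      by rewrite -[in LHS](subrK pi (phi - theta1)) cosDpi.
    by rewrite oppr_le0; apply: cos_ge0_pihalf; apply/andP; split; lra.
  have -> : cos (phi - theta2) = - cos (phi - theta2 - pi).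
    by rewrite -[in LHS](subrK pi (phi - theta2)) cosDpi.
  by rewrite oppr_le0; apply: cos_ge0_pihalf; apply/andP; split; lra.
rewrite -EFinD; congr (_ %:E); rewrite midE aE.
have -> : (theta1 + theta2) / 2 - theta1 = (theta2 - theta1) / 2 by lra.
have -> : theta1 - pi / 2 - theta1 = - (pi / 2) by lra.
have -> : theta2 + pi / 2 - theta2 = pi / 2 by lra.
have -> : (theta1 + theta2) / 2 - theta2 = - ((theta2 - theta1) / 2) by lra.
rewrite !sinN sin_pihalf !mulrN mulr1 !arsinhN arsinh_sinh.
by ring.
Qed.

End IntensityOfHittingLines.

(** * First void set of a Poisson process *)

Section VoidProbabilities.
Context {R : realType} {d : measure_display} {T : measurableType d}.
Context (P : probability T R) {U : Type} (X : T -> set U).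
Context (good : set U -> Prop) (m : set U -> R).

Definition void (A : set U) : set T := [set w | X w `&` A = set0].

Context (good0 : good set0)
  (goodU : forall A B, good A -> good B -> good (A `|` B))
  (goodD : forall A B, good A -> good B -> good (A `\` B))
  (mU : forall A B, good A -> good B -> A `&` B = set0 -> m (A `|` B) = m A + m B)
  (measurable_void : forall A, good A -> measurable (void A))
  (void_prob : forall A, good A -> fine (P (void A)) = expR (- m A)).

Context (S : nat -> set U) (goodS : forall k, good (S k)).

(** The extra set [A] lets inductions close: intersecting with the event that [S n] is void amounts
    to adding [S n] to [A], so every such probability reduces to void probabilities. *)
Fixpoint void_hit n (A : set U) : set T :=
  if n is k.+1 then void_hit k A `&` ~` void (S k) else void A.

Lemma voidU A B : void (A `|` B) = void A `&` void B.
Proof.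
by apply/seteqP; split => w; rewrite /void /= setIUr setU_eq0.
Qed.

Lemma void_hitU n A B : void_hit n (A `|` B) = void_hit n A `&` void B.
Proof. by elim: n => [|n IH] /=; rewrite ?voidU // IH setIAC. Qed.

Lemma measurable_void_hit n A : good A -> measurable (void_hit n A).
Proof.
move=> gA; elim: n => [|n IH] /=; first exact: measurable_void.
by apply: measurableI => //; apply/measurableC/measurable_void.
Qed.

Lemma void_hitS_prob n A : good A ->
  fine (P (void_hit n.+1 A)) =
  fine (P (void_hit n A)) - fine (P (void_hit n (A `|` S n))).
Proof.
move=> gA; have mA := measurable_void_hit n gA.
have mS := measurable_void (goodS n).
rewrite (measureDI P mA mS) void_hitU fineD ?fin_num_measure //=; last first.
- exact: measurableI.
- exact: measurableD.
by rewrite setDE addrK.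
Qed.

(* As in Renyi's theorem, void probabilities are enough here: independence of
   the process on disjoint sets is not used. *)
Lemma void_hit_indep n A D : good A -> good D -> A `&` D = set0 ->
  (forall i, (i < n)%N -> S i `&` D = set0) ->
  fine (P (void_hit n (A `|` D))) = expR (- m D) * fine (P (void_hit n A)).
Proof.
move=> + gD; elim: n A => [|n IH] A gA AD SD.
  rewrite /= !void_prob ?mU //; last exact: goodU.
  by rewrite opprD expRD mulrC.
rewrite !void_hitS_prob //; last exact: goodU.
have SD' i : (i < n)%N -> S i `&` D = set0 by move=> /ltnW; exact: SD.
rewrite setUAC (IH A) // (IH (A `|` S n)) //; first by ring.
  exact: goodU.
by rewrite setIUl AD SD // setU0.
Qed.

Context (N : nat) (between : forall i k j, (i < k)%N -> (k < j)%N -> (j < N)%N ->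
  S i `&` S j `<=` S k).

Definition first_void k : R := fine (P (void_hit k (S k))).

Lemma first_void_ge0 k : 0 <= first_void k.
Proof. exact/fine_ge0/measure_ge0. Qed.

(** By [between], the difference of [S j] and [S k] misses every [S i] with [i < k]. It is thus
    disjoint from all sets that the event of [first_void k] involves, and its void probability
    factors out. *)
Lemma first_void_then k j : (k <= j)%N -> (j < N)%N ->
  fine (P (void_hit k (S j `|` S k))) = expR (- m (S j `\` S k)) * first_void k.
Proof.
move=> kj jN.
have -> : S j `|` S k = S k `|` (S j `\` S k).
  by rewrite classical_sets.setUDr setDv setD0 setUC.
apply: void_hit_indep => //; first exact: goodD.
  by apply/seteqP; split => x //= [Sk [_ /(_ Sk)]].
move=> i ik; apply/seteqP; split => x //= [Si [Sj nSk]]; apply: nSk.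
move: kj; rewrite leq_eqVlt => /predU1P[kj|kj]; first by rewrite kj.
by apply: (between ik kj jN).
Qed.

(* Conditioning on the first void set: given [first_void k], the void
   probability of [S j] is that of [S j `\` S k]. *)
Lemma void_prob_first j : (j < N)%N ->
  expR (- m (S j)) =
  \sum_(k < j.+1) expR (- m (S j `\` S k)) * first_void k.
Proof.
move=> jN.
have step n : (n <= j)%N -> expR (- m (S j)) =
    \sum_(k < n) expR (- m (S j `\` S k)) * first_void k +
    fine (P (void_hit n (S j))).
  elim: n => [|n IH] nj; first by rewrite big_ord0 add0r void_prob.
  rewrite IH 1?ltnW // void_hitS_prob // first_void_then // 1?ltnW //.
  by rewrite big_ord_recr /=; ring.
rewrite (step _ (leqnn j)) big_ord_recr /=; congr (_ + _).
by rewrite -first_void_then // setUid.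
Qed.

(** The complement is [void_hit n set0]: every set is hit and nothing is required to be void. By
    [void_hitS_prob] its probability loses [first_void n] when [n] increases by one. *)
Lemma some_void_prob n : (n <= N)%N ->
  fine (P [set w | exists2 k, (k < n)%N & void (S k) w]) = \sum_(k < n) first_void k.
Proof.
move=> nN.
have -> : [set w | exists2 k, (k < n)%N & void (S k) w] = ~` void_hit n set0.
  elim: n {nN} => [|n IH] /=.
    by apply/seteqP; split => w /=; [case|rewrite /void /= setI0 => /(_ erefl)].
  rewrite setCI setCK -IH; apply/seteqP; split => w /=.
    move=> [k]; rewrite ltnS leq_eqVlt => /predU1P[->|kn] v; first by right.
    by left; exists k.
  move=> [[k kn v]|v]; first by exists k => //; exact: ltnW.
  by exists n.
have mv := measurable_void_hit n good0.
rewrite probability_setC // fineB ?fin_num_measure //=.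
have -> : fine (P (void_hit n set0)) = 1 - \sum_(k < n) first_void k.
  elim: n nN {mv} => [|n IH] nN.
    rewrite big_ord0 subr0 /=.
    have -> : void set0 = setT.
      by apply/seteqP; split => w //= _; rewrite /void /= setI0.
    by rewrite probability_setT.
  rewrite void_hitS_prob // IH 1?ltnW // set0U big_ord_recr /= /first_void.
  by rewrite opprD addrA.
by rewrite opprB addrC subrK.
Qed.

(** Regroups the pairs [k <= j] by first index and gap, because the bounds on the conditional
    probabilities depend on the gap only. *)
Lemma sum_triangle (w : nat -> nat -> R) n :
  \sum_(j < n) \sum_(k < j.+1) w k j = \sum_(k < n) \sum_(i < n - k) w k (k + i)%N.
Proof.
elim: n => [|n IH]; first by rewrite !big_ord0.
rewrite big_ord_recr /= IH [RHS]big_ord_recr /= subSnn big_ord1 addn0.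
rewrite big_ord_recr /= addrA; congr (_ + _); rewrite -big_split /=.
apply: eq_bigr => k _; rewrite subSn 1?ltnW // big_ord_recr /=.
by rewrite subnKC // ltnW.
Qed.

(** On the left is the expected number of void sets. Given that the first is [S k], the expected
    number from [k] on is at most the sum of [a], which may be extended to all gaps below [N] as its
    terms are nonnegative. *)
Lemma some_void_lower (a : nat -> R) : (forall i, 0 <= a i) ->
  (forall k j, (k <= j)%N -> (j < N)%N -> expR (- m (S j `\` S k)) <= a (j - k)%N) ->
  \sum_(j < N) expR (- m (S j)) <=
  fine (P [set w | exists2 k, (k < N)%N & void (S k) w]) * \sum_(i < N) a i.
Proof.
move=> a0 aw; rewrite some_void_prob // mulr_suml.
under eq_bigr => j _ do rewrite void_prob_first //.
rewrite (sum_triangle (fun k j => expR (- m (S j `\` S k)) * first_void k)).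
apply: ler_sum => k _; rewrite mulr_sumr.
apply: (@le_trans _ _ (\sum_(i < N - k) first_void k * a i)).
  apply: ler_sum => i _; rewrite mulrC ler_wpM2l ?first_void_ge0 //.
  have := aw k (k + i)%N; rewrite addKn; apply; first exact: leq_addr.
  by have := ltn_ord i; lia.
rewrite (big_ord_widen N (fun i => first_void k * a i)) ?leq_subr // big_mkcond /=.
apply: ler_sum => i _; case: ifP => // _.
by rewrite mulr_ge0 ?first_void_ge0.
Qed.

(** The grid is twice as long as the range of first indices, so every [k < n] has at least [n] gaps
    available and collects the whole sum of [b]. *)
Lemma some_void_upper (b : nat -> R) (n : nat) : N = n.*2 ->
  (forall k j, (k <= j)%N -> (j < N)%N -> b (j - k)%N <= expR (- m (S j `\` S k))) ->
  (forall i, 0 <= b i) ->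
  fine (P [set w | exists2 k, (k < n)%N & void (S k) w]) * \sum_(i < n) b i <=
  \sum_(j < N) expR (- m (S j)).
Proof.
move=> Nn bw b0; have nN : (n <= N)%N by rewrite Nn -addnn leq_addr.
rewrite some_void_prob // mulr_suml.
under [leRHS]eq_bigr => j _ do rewrite void_prob_first //.
rewrite (sum_triangle (fun k j => expR (- m (S j `\` S k)) * first_void k)).
apply: (@le_trans _ _ (\sum_(k < n) \sum_(i < N - k) expR (- m (S (k + i)%N `\` S k)) * first_void k)); last first.
  rewrite (big_ord_widen N (fun k => \sum_(i < N - k) expR (- m (S (k + i)%N `\` S k)) * first_void k)) // big_mkcond /=.
  apply: ler_sum => k _; case: ifP => // _.
  by apply: sumr_ge0 => i _; rewrite mulr_ge0 ?expR_ge0 ?first_void_ge0.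
apply: ler_sum => k _; rewrite mulr_sumr.
have nk : (n <= N - k)%N by have := ltn_ord k; lia.
rewrite (big_ord_widen (N - k) (fun i => first_void k * b i)) // big_mkcond /=.
apply: ler_sum => i _; case: ifP => _; last first.
  by rewrite mulr_ge0 ?expR_ge0 ?first_void_ge0.
rewrite [leRHS]mulrC ler_wpM2l ?first_void_ge0 //.
have := bw k (k + i)%N; rewrite addKn; apply; first exact: leq_addr.
by have := ltn_ord i; lia.
Qed.

End VoidProbabilities.

(** * Lines hitting two segments hit those in between *)

Section AngularConvexity.
Context {R : realType}.
Implicit Types (r theta a b : R).

Lemma hitting_periodic r theta : hitting r (theta + 2 * pi) = hitting r theta.
Proof. by rewrite /hitting mulrC mulr_natr cosD2pi sinD2pi. Qed.

Lemma hitting_disc r theta : hitting r theta `<=` @disc R.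
Proof. by move=> x []. Qed.

(** The unit vector at [theta] combines those at [a] and [b] with weights [sin (b - theta)] and
    [sin (theta - a)] over [sin (b - a)]. By the addition formula these sum to at least 1, which
    suffices because [hitting] asks that a linear functional be at least a nonnegative constant. *)
Lemma hitting_convex r theta a b : 0 < r -> a <= theta <= b -> b <= a + pi / 2 ->
  hitting r a `&` hitting r b `<=` hitting r theta.
Proof.
move=> r0 /andP[at_ tb] ba x [[dx xa] [_ xb]]; split => //.
have pi0 := @pi_gt0 R.
have [ab|ab] := leP b a.
  by have -> : theta = a by apply/eqP; rewrite eq_le at_ (le_trans tb ab).
have q0 := sqn_ge0 x; have C0 := cosh_gt0 r; have T0 := sinh_gt0 r0.
have s0 : 0 < sin (b - a) by apply: sin_gt0_pi; apply/andP; split; lra.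
set c := 2 * sqn x * cosh r in xa xb *.
have c0 : 0 <= c by rewrite !mulr_ge0 // ltW.
set k := sinh r * (1 + sqn x).
have k0 : 0 < k by rewrite mulr_gt0 //; lra.
have sb : 0 <= sin (b - theta) by apply: sin_ge0_pi; apply/andP; split; lra.
have sa : 0 <= sin (theta - a) by apply: sin_ge0_pi; apply/andP; split; lra.
have comb : sin (b - a) * (cos theta * x.1 + sin theta * x.2) =
   sin (b - theta) * (cos a * x.1 + sin a * x.2) +
   sin (theta - a) * (cos b * x.1 + sin b * x.2).
  have e1 := cos2Dsin2 theta.
  have h1 : sin (b - a) * cos theta = sin (b - theta) * cos a + sin (theta - a) * cos b.
    by rewrite !sinB; ring.
  have h2 : sin (b - a) * sin theta = sin (b - theta) * sin a + sin (theta - a) * sin b.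
    by rewrite !sinB; ring.
  rewrite mulrDr !mulrA h1 h2; ring.
have sub : sin (b - a) <= sin (b - theta) + sin (theta - a).
  have -> : b - a = (b - theta) + (theta - a) by ring.
  rewrite sinD; apply: lerD.
    by rewrite ler_piMr // cos_le1.
  by rewrite mulrC ler_piMr // cos_le1.
rewrite -(ler_pM2l s0).
have -> : sin (b - a) * (sinh r * (cos theta * x.1 + sin theta * x.2) * (1 + sqn x)) =
   k * (sin (b - a) * (cos theta * x.1 + sin theta * x.2)) by rewrite /k; ring.
rewrite comb.
have xa' : c <= k * (cos a * x.1 + sin a * x.2).
  by apply: le_trans xa _; rewrite /k le_eqVlt; apply/orP; left; apply/eqP; ring.
have xb' : c <= k * (cos b * x.1 + sin b * x.2).
  by apply: le_trans xb _; rewrite /k le_eqVlt; apply/orP; left; apply/eqP; ring.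
apply: (@le_trans _ _ ((sin (b - theta) + sin (theta - a)) * c)).
  by rewrite ler_wpM2r.
have := ler_wpM2l sb xa'; have := ler_wpM2l sa xb'; lra.
Qed.

End AngularConvexity.

Section HittingMeasure.
Context {R : realType} (lambda r : R) (lambda_gt0 : 0 < lambda) (r_gt0 : 0 < r).
Implicit Types (theta a b : R) (A B : set (R * R)).

(** The class [good] for the void-set argument: a ring of sets on which the intensity is a real
    number and the Poisson law applies. *)
Definition finite_intensity A := [/\ measurable A, A `<=` @disc R &
  (line_intensity lambda A < +oo)%E].

Definition intensity A : R := fine (line_intensity lambda A).

Let l0 : 0 <= lambda. Proof. exact: ltW. Qed.

Lemma finite_intensity_fin_num A : finite_intensity A ->
  line_intensity lambda A \is a fin_num.
Proof. by move=> [_ _ h]; rewrite ge0_fin_numE // line_intensity_ge0. Qed.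

Lemma finite_intensity0 : finite_intensity set0.
Proof.
split => //; rewrite /line_intensity preimage_set0 setI0 integral_set0.
exact: ltry.
Qed.

Lemma finite_intensityD A B : finite_intensity A -> finite_intensity B ->
  finite_intensity (A `\` B).
Proof.
move=> [mA dA fA] [mB dB fB]; split.
- exact: measurableD.
- by move=> x [/dA].
- apply: le_lt_trans fA; apply: line_intensityS => //; exact: measurableD.
Qed.

Lemma intensityU A B : finite_intensity A -> finite_intensity B ->
  A `&` B = set0 -> intensity (A `|` B) = intensity A + intensity B.
Proof.
move=> gA gB AB; rewrite /intensity line_intensityU //.
- by rewrite fineD // finite_intensity_fin_num.
- by case: gA.
- by case: gB.
- by rewrite disj_set2E AB eqxx.
Qed.

Lemma finite_intensityU A B : finite_intensity A -> finite_intensity B ->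
  finite_intensity (A `|` B).
Proof.
move=> gA gB; have [mA dA fA] := gA; have [mB dB fB] := gB; split.
- exact: measurableU.
- by move=> x [/dA|/dB].
- have -> : A `|` B = A `|` (B `\` A) by rewrite classical_sets.setUDr setDv setD0.
  have [mBA _ fBA] := finite_intensityD gB gA.
  rewrite line_intensityU //; first exact: lte_add_pinfty.
  by rewrite disj_set2E setDIK eqxx.
Qed.

Lemma le_intensity A B : finite_intensity A -> finite_intensity B ->
  A `<=` B -> intensity A <= intensity B.
Proof.
move=> gA gB AB; rewrite fine_le ?finite_intensity_fin_num //.
by case: gA => ? _ _; case: gB => ? _ _; exact: line_intensityS.
Qed.

(** Sectors start anywhere in a full turn and extend by [pi / 2], beyond the range of
    [hittingU_intensity]; a rotation by [2 * pi] brings the angles back. *)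
Lemma hitting_intensity_wide theta1 theta2 :
  pi / 2 <= theta1 <= pi / 2 + 4 * pi -> theta1 <= theta2 <= theta1 + pi / 2 ->
  line_intensity lambda (hitting r theta1 `|` hitting r theta2) =
  (2 * lambda * (r + arsinh (sinh r * sin ((theta2 - theta1) / 2))))%:E.
Proof.
move=> /andP[t1 t1'] t2; have pi0 := @pi_gt0 R.
have [h|h] := leP theta1 (pi / 2 + 2 * pi); first by rewrite hittingU_intensity ?t1.
have -> : theta1 = (theta1 - 2 * pi) + 2 * pi by ring.
have -> : theta2 = (theta2 - 2 * pi) + 2 * pi by ring.
rewrite !hitting_periodic hittingU_intensity //.
- by congr ((_ * (_ + arsinh (_ * sin (_ / _))))%:E); ring.
- by apply/andP; split; lra.
- by move: t2 => /andP[? ?]; apply/andP; split; lra.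
Qed.

Lemma finite_intensity_hitting theta : pi / 2 <= theta <= pi / 2 + 4 * pi ->
  finite_intensity (hitting r theta).
Proof.
move=> t; split; [exact: measurable_hitting|exact: hitting_disc|].
rewrite -[hitting r theta]setUid hitting_intensity_wide ?ltry //.
by have := @pi_gt0 R; rewrite lexx /= => ?; lra.
Qed.

Lemma intensity_hitting theta : pi / 2 <= theta <= pi / 2 + 4 * pi ->
  intensity (hitting r theta) = 2 * lambda * r.
Proof.
move=> t; rewrite /intensity -[hitting r theta]setUid hitting_intensity_wide //=.
  by rewrite subrr mul0r sin0 mulr0 -sinh0 arsinh_sinh addr0.
by have := @pi_gt0 R; rewrite lexx /= => ?; lra.
Qed.

Let range theta := pi / 2 <= theta <= pi / 2 + 4 * pi.

(** Both sets have intensity [2 * lambda * r], so either difference is the union minus that. The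
    second form serves to compare a direction with the arc that starts there. *)
Lemma intensity_hittingD theta1 theta2 : range theta1 -> range theta2 ->
  theta1 <= theta2 <= theta1 + pi / 2 ->
  intensity (hitting r theta2 `\` hitting r theta1) =
    2 * lambda * arsinh (sinh r * sin ((theta2 - theta1) / 2)) /\
  intensity (hitting r theta1 `\` hitting r theta2) =
    2 * lambda * arsinh (sinh r * sin ((theta2 - theta1) / 2)).
Proof.
move=> t1 t2 t12; have g1 := finite_intensity_hitting t1.
have g2 := finite_intensity_hitting t2.
have key A B : finite_intensity A -> finite_intensity B -> intensity A = 2 * lambda * r ->
    intensity (A `|` B) = 2 * lambda * (r + arsinh (sinh r * sin ((theta2 - theta1) / 2))) ->
    intensity (B `\` A) = 2 * lambda * arsinh (sinh r * sin ((theta2 - theta1) / 2)).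
  move=> gA gB eA; have -> : A `|` B = A `|` (B `\` A).
    by rewrite classical_sets.setUDr setDv setD0.
  rewrite intensityU ?setDIK //; last exact: finite_intensityD.
  by rewrite eA; lra.
have eU : intensity (hitting r theta1 `|` hitting r theta2) =
    2 * lambda * (r + arsinh (sinh r * sin ((theta2 - theta1) / 2))).
  by rewrite /intensity hitting_intensity_wide.
by split; apply: key; rewrite ?intensity_hitting // setUC.
Qed.

End HittingMeasure.

(** * Compactness, and measurability of the visibility event *)

Section CompactProduct.
Context {T U : topologicalType}.

Let ultra_cvg_image {V W : topologicalType} (F : set_system V) (f : V -> W) (C : set W) :
  UltraFilter F -> compact C -> F (f @^-1` C) -> exists2 c, C c & f @ F --> c.
Proof.
move=> FU cC FC; have [c [Cc cl]] := cC (f @ F) _ FC; exists c => // D Dc.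
have [//|nD] := in_ultra_setVsetC (f @^-1` D) FU.
by have [x []] := cl (~` D) D nD Dc.
Qed.

Lemma compact_setX (A : set T) (B : set U) :
  compact A -> compact B -> compact (A `*` B).
Proof.
move=> cA cB; rewrite [compact](compact_ultra (T * U)%type) => F FU FAB.
have [|a Aa Fa] := ultra_cvg_image (f := fst) FU cA.
  by apply: filterS FAB => x [].
have [|b Bb Fb] := ultra_cvg_image (f := snd) FU cB.
  by apply: filterS FAB => x [].
exists (a, b); split => // D /(cvg_pair Fa Fb).
by rewrite nbhs_simpl /=; under eq_fun do rewrite -surjective_pairing.
Qed.

End CompactProduct.

Section BoundedLines.
Context {R : realType}.
Implicit Types r : R.

(** Puts all points whose lines can block a segment of length [r] into one compact set, whatever the
    direction, so that local finiteness applies. With [q] the squared norm, squaring the condition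
    gives [(sinh r * (1 - q))^2 >= 4 q], which is at least 1 beyond the threshold [1 / 4]. *)
Lemma hitting_sqn_le r : 0 < r -> exists2 s : R, s < 1 &
  forall theta, hitting r theta `<=` [set x | sqn x <= s].
Proof.
move=> r0; have H0 := sinh_gt0 r0; have CH := cosh2_sinh2 r.
exists (Num.max 4^-1 (1 - (sinh r)^-1)).
  by rewrite gt_max gtrBl invr_gt0 H0 andbT invf_lt1 // ltr1n.
move=> theta x [dx h] /=; rewrite le_max; have [//|q4 /=] := leP (sqn x) 4^-1.
have q1 := disc_gt0 dx; have C0 := cosh_gt0 r.
set H := sinh r in H0 CH h *; set C := cosh r in CH C0 h; set q := sqn x in h q4 q1 *.
set e := cos theta * x.1 + sin theta * x.2 in h.
have e2 : e ^+ 2 <= q.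
  have -> : q = (cos theta ^+ 2 + sin theta ^+ 2) * (x.1 ^+ 2 + x.2 ^+ 2).
    by rewrite cos2Dsin2 mul1r.
  by have := sqr_ge0 (cos theta * x.2 - sin theta * x.1); rewrite /e; lra.
have h2 : (2 * q * C) ^+ 2 <= (H * e * (1 + q)) ^+ 2.
  have q0 : 0 <= 2 * q * C by rewrite !mulr_ge0 // ltW //; lra.
  by rewrite ler_sqr ?nnegrE // (le_trans q0).
have h3 : 4 * q ^+ 2 * C ^+ 2 <= H ^+ 2 * (1 + q) ^+ 2 * q.
  apply: (@le_trans _ _ ((H * e * (1 + q)) ^+ 2)).
    by apply: le_trans h2; rewrite !exprMn; lra.
  have -> : (H * e * (1 + q)) ^+ 2 = H ^+ 2 * (1 + q) ^+ 2 * e ^+ 2 by ring.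
  by apply: ler_wpM2l => //; rewrite mulr_ge0 ?sqr_ge0.
have qp : 0 < q by lra.
have h4 : 4 * q * C ^+ 2 <= H ^+ 2 * (1 + q) ^+ 2.
  by rewrite -(ler_pM2r qp); lra.
have h5 : 1 <= (H * (1 - q)) ^+ 2.
  rewrite CH in h4; have : 4 * q <= (H * (1 - q)) ^+ 2 by lra.
  by lra.
have h6 : 1 <= H * (1 - q).
  have t0 : 0 <= H * (1 - q) by rewrite mulr_ge0 // ltW.
  by rewrite -ler_sqr ?nnegrE // expr1n.
rewrite lerBrDr -lerBrDl -(ler_pM2l H0) mulfV ?gt_eqF //.
Qed.

Lemma compact_sqn_le (s : R) : s < 1 -> compact [set x : R * R | sqn x <= s].
Proof.
move=> s1; have cl : closed [set x : R * R | sqn x <= s].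
  apply: (@preimage_closed _ _ (@sqn R) [set u | u <= s]); last exact: closed_le.
  move=> x _; have c1 : {for x, continuous (fun y : R * R => y.1 ^+ 2)}.
    exact: (continuous_comp (@cvg_fst _ _ _ _ _) (@exprn_continuous R 2 _)).
  have c2 : {for x, continuous (fun y : R * R => y.2 ^+ 2)}.
    exact: (continuous_comp (@cvg_snd _ _ _ _ _) (@exprn_continuous R 2 _)).
  exact: (cvgD c1 c2).
have cp : compact (`[(-1 : R), 1]%classic `*` `[(-1 : R), 1]%classic).
  by apply: compact_setX; exact: segment_compact.
apply: (subclosed_compact cl cp) => x /= xs; rewrite /sqn in xs.
have := sqr_ge0 x.1; have := sqr_ge0 x.2 => *.
by split; rewrite /= in_itv /=; apply/andP; split; nra.
Qed.

End BoundedLines.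

Section PoissonLines.
Context {R : realType} {d : measure_display} {T : measurableType d}.
Context (P : probability T R) (lambda : R) (lambda_gt0 : 0 < lambda).
Context (X : T -> set (R * R)).
Context (poissonX : poisson_process P (@disc R) (line_intensity lambda) X).
Implicit Types (r theta : R).

Lemma void_num_points A : void X A = [set w | num_points X A w = 0%:R%:E].
Proof.
apply/seteqP; split => w; rewrite /void /num_points /counting /=.
  by move=> ->; rewrite asboolT // fset_set0.
case: asboolP => // fin [] /eqP; rewrite pnatr_eq0 finmap.cardfs_eq0 => /eqP.
exact: fset_set_set0.
Qed.

Lemma measurable_void A : measurable A -> measurable (void X A).
Proof.
move=> mA; rewrite void_num_points.
have := pp_measurable poissonX mA measurableT (emeasurable_set1 0%:R%:E).
by rewrite setTI.
Qed.

Lemma void_probability A : finite_intensity lambda A ->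
  fine (P (void X A)) = expR (- intensity lambda A).
Proof.
move=> gA; have [mA dA fA] := gA.
have e : line_intensity lambda A = (intensity lambda A)%:E.
  by rewrite fineK // finite_intensity_fin_num.
have := pp_law_fin poissonX mA dA e 0.
by rewrite -void_num_points => ->; rewrite fact0 expr0 mulr1 divr1.
Qed.

Lemma visible_directionsP w r theta : 0 <= r ->
  segment r theta `&` line_union (X w) = set0 <-> void X (hitting r theta) w.
Proof.
move=> r0; have sub : X w `<=` @disc R by case: poissonX => + _ _ _ _ _; exact.
split=> [|] /seteqP[h _]; apply/seteqP; split => // x.
  move=> [Xx Hx]; have [z [sz lz]] := (hittingP theta r0 (sub _ Xx)).2 Hx.
  by apply: (h z); split => //; exists x.
move=> [sx [y Xy ly]]; apply: (h y); split => //.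
by apply/(hittingP theta r0 (sub _ Xy)); exists x.
Qed.

(** Only finitely many points of the process can block a segment of length [r], and for each of them
    not blocking is a strict inequality, continuous in the direction. *)
Lemma near_void_hitting w r theta : 0 < r -> void X (hitting r theta) w ->
  \forall t \near theta, void X (hitting r t) w.
Proof.
move=> r0 v; have [s s1 hs] := hitting_sqn_le r0.
have fin : finite_set (X w `&` [set x | sqn x <= s]).
  case: poissonX => _ + _ _ _ _; apply; first exact: compact_sqn_le.
  by move=> x /= xs; exact: le_lt_trans xs s1.
have near_x : \forall t \near theta, (\bigcap_(x in [set` fset_set (X w `&` [set x | sqn x <= s])])
    [set t | ~ hitting r t x]) t.
  apply: filter_bigI => x; rewrite in_fset_set // inE => -[Xx _].
  have dx : disc x by case: poissonX => + _ _ _ _ _; apply; exact: Xx.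
  have nx : sinh r * (cos theta * x.1 + sin theta * x.2) * (1 + sqn x) < 2 * sqn x * cosh r.
    rewrite ltNge; apply/negP => h.
    by move/seteqP : v => [/(_ x) + _]; apply.
  have cf : {for theta, continuous (fun t => sinh r * (cos t * x.1 + sin t * x.2) * (1 + sqn x))}.
    exact: (continuousPM (continuousPM (continuousPc (sinh r) theta)
      (continuousPD (continuousPM (@continuous_cos R theta) (continuousPc x.1 theta))
                    (continuousPM (@continuous_sin R theta) (continuousPc x.2 theta))))
      (continuousPc (1 + sqn x) theta)).
  have lt := @cvgr_lt R _ (nbhs theta) (nbhs_filter theta) _ _ cf _ nx.
  by apply: filterS lt => t /= lt [_]; rewrite leNgt lt.
apply: filterS near_x => t ht; apply/seteqP; split => // x [Xx Hx].
apply: (ht x) => //=; rewrite in_fset_set // inE; split => //; exact: hs Hx.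
Qed.

(** Visibility is an open condition on the direction, so rational directions suffice and the event
    is a countable union. *)
Lemma visible_event r : 0 < r ->
  [set w | visible_directions (X w) r !=set0] =
  \bigcup_(q in [set q : rat | (0 <= (ratr q : R)) && ((ratr q : R) < 2 * pi)]) void X (hitting r (ratr q)).
Proof.
move=> r0; have r0' := ltW r0; apply/seteqP; split => w /=; last first.
  by move=> [q q0 v]; exists (ratr q); split => //; exact/visible_directionsP.
move=> [theta [/andP[t0 t1] /(visible_directionsP _ _ r0') v]].
have /nbhs_ballP[e /= e0 he] := near_void_hitting r0 v.
(* The rational is sought to the right of [theta], which keeps it nonnegative even when
   [theta = 0]. *)
have lt : theta < Num.min (theta + e) (2 * pi) by rewrite lt_min t1 ltrDl e0.
have [q] := rat_in_itvoo lt; rewrite in_itv /= lt_min => /andP[tq /andP[qe q1]].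
exists q; first by rewrite /= q1 (le_trans t0 (ltW tq)).
by apply: he; rewrite /ball /= ltr_norml; apply/andP; split; lra.
Qed.

Lemma measurable_visible_event r : 0 < r ->
  measurable [set w | visible_directions (X w) r !=set0].
Proof.
move=> r0; rewrite visible_event // bigcup_mkcond.
apply: bigcupT_measurable_rat => q; case: ifP => // _.
by apply: measurable_void; exact: measurable_hitting.
Qed.

End PoissonLines.

(** * Elementary estimates: [arsinh], sine, harmonic and zeta sums *)

Section RealBounds.
Context {R : realType}.
Implicit Types (x y beta : R).

(** With [arsinh_le_ln1D], this turns the exponential of an [arsinh] intensity into a power of the
    gap. *)
Lemma ln1D_le_arsinh y : 0 <= y -> ln (1 + y) <= arsinh y.
Proof.
move=> y0; have h := arsinh_arg_gt0 y.
rewrite ler_ln ?posrE //; last by lra.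
rewrite addrC lerD2l -[leLHS]sqrtr1 ler_wsqrtr // lerDl sqr_ge0 //.
Qed.

Lemma arsinh_le_ln1D y : 0 <= y -> arsinh y <= ln (1 + 2 * y).
Proof.
move=> y0; have h := arsinh_arg_gt0 y.
rewrite ler_ln ?posrE //; last by lra.
have : Num.sqrt (1 + y ^+ 2) <= 1 + y; last by lra.
rewrite -[leRHS]ger0_norm; last by lra.
by rewrite -sqrtr_sqr ler_wsqrtr //; nra.
Qed.

Lemma le_arsinh x y : x <= y -> arsinh x <= arsinh y.
Proof.
move=> xy; rewrite leNgt; apply/negP => h.
have : sinh (arsinh y) < sinh (arsinh x).
  by rewrite /sinh ltr_pM2r // ltrB ?ltr_expR // ltrN2 h.
by rewrite !arsinhK; lra.
Qed.

Lemma sin_le_id x : 0 <= x -> sin x <= x.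
Proof.
rewrite le_eqVlt => /predU1P[<-|x0]; first by rewrite sin0.
have [c _] := MVT x0 (fun u _ => is_derive_sin u)
  (continuous_subspaceT (@continuous_sin R)).
by rewrite sin0 !subr0 => ->; rewrite ler_piMl ?cos_le1 // ltW.
Qed.

(** Mean value theorem: on this range the derivative is at least [cos (pi / 4)], which exceeds
    [1 / 2] by the duplication formula. *)
Lemma sin_ge_half x : 0 <= x <= pi / 4 -> x / 2 <= sin x.
Proof.
move=> /andP[]; rewrite le_eqVlt => /predU1P[<-|x0 x4]; first by rewrite sin0 mul0r.
have pi0 := @pi_gt0 R.
have [c] := MVT x0 (fun u _ => is_derive_sin u)
  (continuous_subspaceT (@continuous_sin R)).
rewrite sin0 !subr0 in_itv /= => /andP[c0 cx] ->.
have p4 : 2^-1 <= cos (pi / 4) :> R.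
  have h0 : 0 <= cos (pi / 4) :> R by apply: cos_ge0_pihalf; apply/andP; split; lra.
  have : cos (pi / 4 *+ 2) = 0 :> R.
    by rewrite (_ : pi / 4 *+ 2 = pi / 2) ?cos_pihalf // mulr2n; lra.
  by rewrite cos_mulr2n mulr2n; nra.
have : cos (pi / 4) <= cos c.
  rewrite leNgt ltr_cos ?in_itv /=; first by rewrite -leNgt; lra.
    by apply/andP; split; lra.
  by apply/andP; split; lra.
nra.
Qed.

(** This is [u <= - ln (1 - u)] at [u = 1 / (n + 2)]. *)
Lemma inv_le_ln_ratio (n : nat) :
  (n.+2%:R)^-1 <= ln n.+2%:R - ln n.+1%:R :> R.
Proof.
rewrite -ln_div ?posrE ?ltr0n //.
have e : n.+2%:R / n.+1%:R = (1 - n.+2%:R^-1)^-1 :> R.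
  have k0 : 0 < n.+1%:R :> R by rewrite ltr0n.
  rewrite -[n.+2%:R]natr1; move: (n.+1%:R) k0 => k k0.
  have -> : 1 - (k + 1)^-1 = k / (k + 1) by field; rewrite gt_eqF //; lra.
  by rewrite invf_div.
have lt1 : (n.+2%:R : R)^-1 < 1 by rewrite invf_lt1 ?ltr0n // ltr1n.
rewrite e lnV ?posrE ?subr_gt0 // lerNr; apply: le_ln1Dx.
by rewrite ltrNr opprK.
Qed.

Lemma harmonic_le (n : nat) : (0 < n)%N ->
  \sum_(i < n) (i.+1%:R)^-1 <= 1 + ln n%:R :> R.
Proof.
elim: n => // -[_ _|n IH _]; first by rewrite big_ord1 ln1 invr1 addr0.
rewrite big_ord_recr /=; apply: le_trans (lerD (IH isT) (inv_le_ln_ratio n)) _.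
by rewrite -addrA subrKC.
Qed.

Lemma harmonic_ge (n : nat) : ln (n.+1%:R) <= \sum_(i < n) (i.+1%:R)^-1 :> R.
Proof.
elim: n => [|n IH]; first by rewrite big_ord0 ln1.
rewrite big_ord_recr /=.
have : ln (n.+2%:R) - ln (n.+1%:R) <= (n.+1%:R)^-1 :> R; last first.
  by rewrite lerBlDl => /le_trans; apply; rewrite lerD2r.
rewrite -ln_div ?posrE ?ltr0n //.
have -> : n.+2%:R / n.+1%:R = 1 + n.+1%:R^-1 :> R.
  by rewrite -[n.+2%:R]natr1 mulrDl divff ?mul1r // pnatr_eq0.
by apply: le_ln1Dx; rewrite (lt_trans (ltrN10 _)) // invr_gt0 ltr0n.
Qed.

(* Telescoping against [n^(1 - beta) / (beta - 1)]. *)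
Lemma zeta_sum_le beta (n : nat) : 1 < beta ->
  \sum_(i < n) expR (- (beta * ln i.+1%:R)) <= 1 + (beta - 1)^-1.
Proof.
move=> b1; pose g := beta - 1; have g0 : 0 < g by rewrite /g; lra.
have ginv : 0 < g^-1 by rewrite invr_gt0.
case: n => [|n]; first by rewrite big_ord0; rewrite -/g; lra.
apply: (@le_trans _ _ (1 + g^-1 * (1 - expR (- (g * ln n.+1%:R))))); last first.
  by rewrite -/g lerD2l ler_piMr ?(ltW ginv) // gerBl expR_ge0.
elim: n => [|n IH].
  by rewrite big_ord1 ln1 !mulr0 oppr0 expR0 subrr mulr0 addr0.
rewrite big_ord_recr /=; apply: le_trans (lerD IH (lexx _)) _.
set L1 := ln n.+1%:R; set L2 := ln n.+2%:R.
have ratio : (n.+2%:R)^-1 <= L2 - L1 by exact: inv_le_ln_ratio.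
have e1 : expR (- (g * L1)) = expR (- (g * L2)) * expR (g * (L2 - L1)).
  by rewrite -expRD; congr expR; ring.
have e2 : expR (- (beta * L2)) = expR (- (g * L2)) * n.+2%:R^-1.
  have -> : (n.+2%:R : R)^-1 = expR (- L2) by rewrite expRN lnK ?posrE ?ltr0n.
  by rewrite -expRD; congr expR; rewrite /g; ring.
have h1 := expR_ge1Dx (g * (L2 - L1)).
have e0 := expR_gt0 (- (g * L2)).
have : expR (- (beta * L2)) <= g^-1 * (expR (- (g * L1)) - expR (- (g * L2))).
  rewrite e1 e2.
  have -> : g^-1 * (expR (- (g * L2)) * expR (g * (L2 - L1)) - expR (- (g * L2))) =
    expR (- (g * L2)) * (g^-1 * (expR (g * (L2 - L1)) - 1)) by ring.
  rewrite ler_pM2l //; apply: le_trans ratio _.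
  by rewrite -(ler_pM2l g0) mulrA divff ?gt_eqF // mul1r; lra.
by lra.
Qed.

End RealBounds.

(** * Bounds on the visibility probability *)

Section VisibilityBounds.
Context {R : realType} {d : measure_display} {T : measurableType d}.
Context (P : probability T R) (lambda : R) (lambda_gt0 : 0 < lambda).
Context (X : T -> set (R * R)).
Context (poissonX : poisson_process P (@disc R) (line_intensity lambda) X).
Context (r : R) (r_gt0 : 0 < r).

Let l0 : 0 <= lambda. Proof. exact: ltW. Qed.

Let E := [set w | visible_directions (X w) r !=set0].

Let measurable_void_fin A : finite_intensity lambda A -> measurable (void X A).
Proof. by move=> [mA _ _]; exact: (measurable_void poissonX). Qed.

Let measurable_some_void (S : nat -> set (R * R)) n :
  (forall k, finite_intensity lambda (S k)) ->
  measurable [set w | exists2 k, (k < n)%N & void X (S k) w].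
Proof.
move=> gS.
have -> : [set w | exists2 k, (k < n)%N & void X (S k) w] =
    \bigcup_(k in [set k | (k < n)%N]) void X (S k) by [].
by apply: bigcup_measurable => k _; exact: measurable_void_fin.
Qed.

Lemma finite_intensityI A B : finite_intensity lambda A -> finite_intensity lambda B ->
  finite_intensity lambda (A `&` B).
Proof.
move=> gA gB; rewrite -setDD.
exact: (finite_intensityD lambda_gt0 gA (finite_intensityD lambda_gt0 gA gB)).
Qed.

Lemma visible_prob_lower (n : nat) : (0 < n)%N -> n%:R <= 2 * sinh r ->
  n%:R * expR (- (2 * lambda * r)) <=
  fine (P E) * \sum_(i < n) expR (- (2 * lambda * ln (1 + i%:R / 8))).
Proof.
move=> n0 nT; have pi0 := @pi_gt0 R; have pi2 := @pi_ge2 R.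
have nR : 0 < n%:R :> R by rewrite ltr0n.
pose delta : R := pi / 2 / n%:R.
have dn : delta * n%:R = pi / 2 by rewrite divfK // gt_eqF.
have d0 : 0 < delta by rewrite divr_gt0 // divr_gt0.
(* [minn] freezes the directions after the last grid point: the void-set lemmas ask for finite
   intensity of [S k] at every natural [k]. *)
pose th k : R := pi / 2 + delta * (minn k n)%:R.
have thS k : pi / 2 <= th k <= pi / 2 + pi / 2.
  apply/andP; split; first by rewrite /th lerDl mulr_ge0 ?ler0n // ltW.
  by rewrite /th lerD2l -dn ler_pM2l // ler_nat geq_minr.
have rg k : pi / 2 <= th k <= pi / 2 + 4 * pi.
  by have /andP[-> h] := thS k; lra.
have mono i j : (i <= j)%N -> th i <= th j.
  move=> ij; rewrite /th lerD2l ler_pM2l // ler_nat leq_min geq_minr andbT.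
  by rewrite (leq_trans (geq_minl _ _)).
have near_th i j : th j <= th i + pi / 2.
  by have /andP[h1 _] := thS i; have /andP[_ h2] := thS j; lra.
pose S k := hitting r (th k).
have goodS k : finite_intensity lambda (S k) by exact: finite_intensity_hitting.
have between i k j : (i < k)%N -> (k < j)%N -> (j < n)%N -> S i `&` S j `<=` S k.
  by move=> ik kj _; apply: hitting_convex; rewrite ?mono // ltnW.
have := some_void_lower (finite_intensity0 lambda) (finite_intensityU lambda_gt0)
  (finite_intensityD lambda_gt0) (intensityU lambda_gt0) measurable_void_fin
  (void_probability lambda_gt0 poissonX) goodS between
  (a := fun i => expR (- (2 * lambda * ln (1 + i%:R / 8)))).
move=> /(_ (fun=> expR_ge0 _)) low.
have {low} : \sum_(j < n) expR (- intensity lambda (S j)) <=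
    fine (P [set w | exists2 k, (k < n)%N & void X (S k) w]) *
    \sum_(i < n) expR (- (2 * lambda * ln (1 + i%:R / 8))).
  apply: low => k j kj jn; rewrite ler_expR lerN2.
  have [-> _] := intensity_hittingD lambda_gt0 r_gt0 (rg k) (rg j)
    (introT andP (conj (mono _ _ kj) (near_th k j))).
  rewrite ler_pM2l ?mulr_gt0 //.
  apply: le_trans (ln1D_le_arsinh _) _; first by rewrite divr_ge0.
  apply: le_arsinh.
  have -> : th j - th k = delta * (j - k)%:R.
    rewrite /th (minn_idPl (ltnW jn)) (minn_idPl (leq_trans kj (ltnW jn))) natrB //.
    by ring.
  set m := (j - k)%:R : R.
  have m0 : 0 <= m by rewrite ler0n.
  have mn : m <= n%:R by rewrite ler_nat (leq_trans (leq_subr _ _)) // ltnW.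
  have dm : delta * m <= pi / 2 by rewrite -dn ler_pM2l.
  have dm0 : 0 <= delta * m by rewrite mulr_ge0 // ltW.
  (* Origin of the 8: the half angle and [sin x >= x / 2] cost a factor 4, [sinh r >= n / 2] costs
     2, and [n * delta = pi / 2] is at least 1. *)
  have h : delta * m / 2 / 2 <= sin (delta * m / 2).
    by apply: sin_ge_half; apply/andP; split; lra.
  have T0 := sinh_gt0 r_gt0.
  apply: (@le_trans _ _ (sinh r * (delta * m / 2 / 2))); last by rewrite ler_pM2l.
  have h2 : n%:R * (delta * m) <= 2 * sinh r * (delta * m) by rewrite ler_wpM2r.
  have h3 : n%:R * (delta * m) = pi / 2 * m by rewrite -dn; ring.
  have h4 : 2 * m <= pi * m by rewrite ler_wpM2r.
  by lra.
have -> : \sum_(j < n) expR (- intensity lambda (S j)) = n%:R * expR (- (2 * lambda * r)).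
  under eq_bigr => j _ do rewrite intensity_hitting //.
  by rewrite sumr_const card_ord -[LHS]mulr_natl.
move/le_trans; apply; rewrite ler_wpM2r //.
  by apply: sumr_ge0 => i _; exact: expR_ge0.
have mE : measurable E by exact: (measurable_visible_event poissonX r_gt0).
have mS := measurable_some_void n goodS.
apply: fine_le; rewrite ?fin_num_measure //; apply: le_measure; rewrite ?inE //.
move=> w [k kn v]; exists (th k); split.
  by have /andP[h1 h2] := thS k; apply/andP; split; lra.
exact/(visible_directionsP poissonX _ _ (ltW r_gt0)).
Qed.

Section Sector.
Context (n : nat) (n_gt0 : (0 < n)%N) (sinh_n : sinh r <= n%:R).
Context (a : R) (a_range : pi / 2 <= a <= pi / 2 + 2 * pi).

Let nR : 0 < n%:R :> R. Proof. by rewrite ltr0n. Qed.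
(** The grid has [2 n] steps over a quarter turn. Visible directions are sought in its first half,
    an angle [pi / 4]; the second half provides the [n] gaps that [some_void_upper] needs. *)
Let delta : R := pi / 4 / n%:R.
Let th k : R := a + delta * (minn k n.*2)%:R.
Let dn : n%:R * delta = pi / 4.
Proof. by rewrite mulrC divfK // gt_eqF. Qed.
Let d0 : 0 < delta. Proof. by rewrite divr_gt0 // divr_gt0 // pi_gt0. Qed.

Let th_range k : a <= th k <= a + pi / 2.
Proof.
apply/andP; split; first by rewrite /th lerDl mulr_ge0 ?ler0n // ltW.
rewrite /th lerD2l (_ : pi / 2 = delta * n.*2%:R).
  by rewrite ler_pM2l // ler_nat geq_minr.
by rewrite -muln2 natrM mulrA [delta * _]mulrC dn; lra.
Qed.

Let rg k : pi / 2 <= th k <= pi / 2 + 4 * pi.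
Proof.
have pi0 := @pi_gt0 R; have /andP[h1 h2] := th_range k.
by move/andP: a_range => [? ?]; apply/andP; split; lra.
Qed.

Let mono i j : (i <= j)%N -> th i <= th j.
Proof.
move=> ij; rewrite /th lerD2l ler_pM2l // ler_nat leq_min geq_minr andbT.
by rewrite (leq_trans (geq_minl _ _)).
Qed.

Let near_th i j : th j <= th i + pi / 2.
Proof. by have /andP[h1 _] := th_range i; have /andP[_ h2] := th_range j; lra. Qed.

Let th_diff i j : (i <= j)%N -> th j - th i <= delta * (j - i)%:R.
Proof.
move=> ij; rewrite /th opprD addrACA subrr add0r -mulrBr ler_pM2l //.
rewrite -natrB; last by rewrite leq_min geq_minr andbT (leq_trans (geq_minl _ _)).
by rewrite ler_nat; lia.
Qed.

Let S k := hitting r (th k) `&` hitting r (th k.+1).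

Let goodH k : finite_intensity lambda (hitting r (th k)).
Proof. exact: finite_intensity_hitting. Qed.

Let goodS k : finite_intensity lambda (S k).
Proof. exact: finite_intensityI. Qed.

(** Since [sin x <= x] and [sinh r * delta <= n * delta = pi / 4 <= 1], the argument of [arsinh] is
    at most half the number of steps, and the factor 2 in [arsinh_le_ln1D] absorbs the half. *)
Let intensity_th_diff i j : (i < j)%N ->
  intensity lambda (hitting r (th j) `\` hitting r (th i)) <=
    2 * lambda * ln (1 + (j - i)%:R) /\
  intensity lambda (hitting r (th i) `\` hitting r (th j)) <=
    2 * lambda * ln (1 + (j - i)%:R).
Proof.
move=> ij; have pi0 := @pi_gt0 R; have pi4 := @pihalf_lt2 R.
have [-> ->] := intensity_hittingD lambda_gt0 r_gt0 (rg i) (rg j)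
    (introT andP (conj (mono (ltnW ij)) (near_th i j))).
suff h : arsinh (sinh r * sin ((th j - th i) / 2)) <= ln (1 + (j - i)%:R).
  by split; rewrite ler_pM2l ?mulr_gt0.
have dth := th_diff (ltnW ij); have thm := mono (ltnW ij).
set m := (j - i)%:R : R; rewrite -/m in dth.
have m0 : 0 <= m by rewrite ler0n.
have T0 := sinh_gt0 r_gt0.
have -> : 1 + m = 1 + 2 * (m / 2) by lra.
apply: le_trans (arsinh_le_ln1D _); last by rewrite divr_ge0.
apply: le_arsinh.
apply: (@le_trans _ _ (sinh r * ((th j - th i) / 2))).
  by rewrite ler_pM2l // sin_le_id //; lra.
apply: (@le_trans _ _ (sinh r * (delta * m / 2))); first by rewrite ler_pM2l //; lra.
have dm0 : 0 <= delta * m by rewrite mulr_ge0 // ltW.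
have h2 : sinh r * (delta * m) <= n%:R * (delta * m) by rewrite ler_wpM2r.
have h3 : n%:R * (delta * m) = pi / 4 * m by rewrite mulrA dn.
have h4 : pi / 4 * m <= m by rewrite ler_piMl //; lra.
by lra.
Qed.

Definition sector_event : set T :=
  [set w | exists2 k, (k < n)%N & void X (S k) w].

Lemma measurable_sector_event : measurable sector_event.
Proof. exact: measurable_some_void. Qed.

(** A line in [S j] but not in [S k] either misses direction [th k], or hits it and misses
    [th k.+1]. Up to the factor [2 * lambda] the first kind has intensity at most [ln (j - k + 2)],
    because [S j] reaches up to [th j.+1], and the second at most [ln 2]. Likewise [S j] lacks at
    most [2 * lambda * ln 2] of the intensity of one segment. *)
Lemma sector_event_prob :
  fine (P sector_event) *
    \sum_(i < n) expR (- (2 * lambda * (ln (i%:R + 2) + ln 2))) <=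
  n.*2%:R * expR (- (2 * lambda * (r - ln 2))).
Proof.
have ln2 k : intensity lambda (hitting r (th k) `\` hitting r (th k.+1)) <= 2 * lambda * ln 2.
  by have [_] := intensity_th_diff (ltnSn k); rewrite subSnn.
have between i k j : (i < k)%N -> (k < j)%N -> (j < n.*2)%N -> S i `&` S j `<=` S k.
  move=> ik kj _ x [[Hi _] [_ Hj]].
  have [ik' kj'] : (i <= k.+1)%N /\ (k <= j.+1)%N by split; apply: leqW; exact: ltnW.
  split; apply: (hitting_convex r_gt0 _ (near_th _ _) (conj Hi Hj)).
    by rewrite (mono (ltnW ik)) (mono kj').
  by rewrite (mono ik') (mono (leqW kj)).
have up := some_void_upper (finite_intensity0 lambda) (finite_intensityU lambda_gt0)
  (finite_intensityD lambda_gt0) (intensityU lambda_gt0) measurable_void_fin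
  (void_probability lambda_gt0 poissonX) goodS between
  (b := fun i => expR (- (2 * lambda * (ln (i%:R + 2) + ln 2)))) erefl.
apply: le_trans (up _ (fun=> expR_ge0 _)) _.
  move=> k j kj jn; rewrite ler_expR lerN2.
  have gD1 : finite_intensity lambda (hitting r (th j.+1) `\` hitting r (th k)).
    exact: finite_intensityD.
  have gD2 : finite_intensity lambda (hitting r (th k) `\` hitting r (th k.+1)).
    exact: finite_intensityD.
  have gSS : finite_intensity lambda (S j `\` S k) by exact: finite_intensityD.
  apply: le_trans (le_intensity lambda_gt0 gSS (finite_intensityU lambda_gt0 gD1 gD2) _) _.
    move=> x [[_ Hj] nS]; have [Hk|nHk] := pselect (hitting r (th k) x).
      by right; split => // Hk1; apply: nS.
    by left.
  rewrite (intensityU lambda_gt0) //; last first.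
    by apply/seteqP; split => // x [[_ nk] [/nk]].
  rewrite mulrDr; apply: lerD; last exact: ln2.
  have [h _] := intensity_th_diff (i := k) (j := j.+1) kj.
  by rewrite subSn // -[X in ln (1 + X)]natr1 in h; rewrite [_ + 2](_ : _ = 1 + ((j - k)%:R + 1)) //; lra.
set e := expR _; have -> : n.*2%:R * e = \sum_(j < n.*2) e.
  by rewrite sumr_const card_ord -[RHS]mulr_natl.
apply: ler_sum => j _; rewrite /e.
rewrite ler_expR lerN2.
have : intensity lambda (hitting r (th j)) =
    intensity lambda (S j) + intensity lambda (hitting r (th j) `\` hitting r (th j.+1)).
  rewrite -(intensityU lambda_gt0) //.
  - by rewrite setUIDK.
  - exact: finite_intensityD.
  - by apply/seteqP; split => // x [[_ h] [_ /(_ h)]].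
rewrite intensity_hitting // => eS; have := ln2 j; lra.
Qed.

(** Lines hitting both ends of the arc around [theta] also hit the segment at [theta], so a visible
    direction leaves the set of its arc void. *)
Lemma sector_eventP w theta : a <= theta < a + pi / 4 ->
  void X (hitting r theta) w -> sector_event w.
Proof.
move=> /andP[at_ ta] v; have pi0 := @pi_gt0 R.
have x0 : 0 <= (theta - a) / delta by rewrite divr_ge0 ?subr_ge0 // ltW.
have /andP[k1 k2] := truncn_itv x0; set k := Num.truncn _ in k1 k2.
rewrite ler_pdivlMr // in k1; rewrite ltr_pdivrMr // in k2.
have kn : (k < n)%N.
  rewrite -(ltr_nat R) -(ltr_pM2r d0) dn; apply: le_lt_trans k1 _; lra.
exists k => //; have k2n' : (k.+1 <= n.*2)%N by rewrite -addnn (leq_trans kn) ?leq_addr.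
have k2n := ltnW k2n'.
have sub : S k `<=` hitting r theta.
  apply: hitting_convex => //; apply/andP; split.
    by rewrite /th (minn_idPl k2n) mulrC; lra.
  by rewrite /th (minn_idPl k2n') mulrC; lra.
rewrite /void /=; apply/seteqP; split => // x [Xx Sx].
by move/seteqP : v => [/(_ x) + _]; apply; split => //; exact: sub.
Qed.

End Sector.

Lemma visible_prob_upper (n : nat) : (0 < n)%N -> sinh r <= n%:R ->
  fine (P E) * \sum_(i < n) expR (- (2 * lambda * (ln (i%:R + 2) + ln 2))) <=
  8 * (n.*2%:R * expR (- (2 * lambda * (r - ln 2)))).
Proof.
move=> n0 nT; have pi0 := @pi_gt0 R.
(* Eight sectors of angle [pi / 4] make a full turn. They start at [pi / 2], as the intensity
   formulas require; directions below it are reached after adding [2 * pi]. *)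
pose a (q : nat) : R := pi / 2 + q%:R * (pi / 4).
pose F q := sector_event n (a q).
have rg q : (q < 8)%N -> pi / 2 <= a q <= pi / 2 + 2 * pi.
  move=> q8; have q0 : 0 <= q%:R :> R by rewrite ler0n.
  have q8' : q%:R <= 8 :> R by rewrite ler_nat ltnW.
  rewrite /a lerDl mulr_ge0 //=; last by lra.
  have : q%:R * (pi / 4) <= 8 * (pi / 4) :> R by rewrite ler_wpM2r //; lra.
  by lra.
have mF q : (q < 8)%N -> measurable (F q).
  by move=> /rg h; exact: measurable_sector_event.
have mE : measurable E by exact: (measurable_visible_event poissonX r_gt0).
have cover : E `<=` \big[setU/set0]_(q < 8) F q.
  move=> w [theta [/andP[t0 t1] /(visible_directionsP poissonX _ _ (ltW r_gt0)) v]].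
  have [t [ta tb vt]] : exists t, [/\ pi / 2 <= t, t < pi / 2 + 2 * pi & void X (hitting r t) w].
    have [h|h] := leP (pi / 2) theta; first by exists theta; split => //; lra.
    by exists (theta + 2 * pi); rewrite hitting_periodic; split => //; lra.
  have p4 : 0 < pi / 4 :> R by lra.
  have x0 : 0 <= (t - pi / 2) / (pi / 4) by rewrite divr_ge0 ?subr_ge0 // ltW.
  have /andP[k1 k2] := truncn_itv x0; set q := Num.truncn _ in k1 k2.
  rewrite ler_pdivlMr // in k1; rewrite ltr_pdivrMr // in k2.
  have q8 : (q < 8)%N by rewrite -(ltr_nat R) -(ltr_pM2r p4); apply: le_lt_trans k1 _; lra.
  rewrite -bigcup_mkord; exists q => //.
  by apply: (sector_eventP n0 _ vt); apply/andP; split; rewrite /a; lra.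
have PE : fine (P E) <= \sum_(q < 8) fine (P (F q)).
  rewrite -lee_fin -sumEFin fineK ?fin_num_measure //.
  apply: le_trans (@content_subadditive _ _ _ P E F 8 mF mE cover) _.
  apply: lee_sum => q _; rewrite fineK // fin_num_measure //; exact: mF.
apply: (@le_trans _ _ ((\sum_(q < 8) fine (P (F q))) *
   \sum_(i < n) expR (- (2 * lambda * (ln (i%:R + 2) + ln 2))))).
  by rewrite ler_wpM2r // sumr_ge0 // => i _; exact: expR_ge0.
rewrite mulr_suml.
apply: (@le_trans _ _ (\sum_(q < 8) n.*2%:R * expR (- (2 * lambda * (r - ln 2))))).
  by apply: ler_sum => q _; apply: sector_event_prob => //; exact: rg.
by rewrite sumr_const card_ord -[X in X <= _]mulr_natl.
Qed.

End VisibilityBounds.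

(** * Choice of the grid size and of the constants *)

Section Asymptotics.
Context {R : realType}.
Implicit Types (lambda r : R).

Let sinh_bounds r : 6 <= r -> [/\ expR r / 4 <= sinh r, sinh r <= expR r / 2 & 1 <= sinh r].
Proof.
move=> r6; have e7 := expR_ge1Dx r.
have h : expR (- r) <= 1 by rewrite -expR0 ler_expR; lra.
have h0 := expR_gt0 (- r).
by rewrite /sinh; split; lra.
Qed.

(** The integer part of [sinh r] plus one serves both estimates: the lower one needs
    [n <= 2 * sinh r], the upper one [sinh r <= n]. *)
Let grid_size r : 6 <= r -> exists n : nat,
  [/\ (0 < n)%N, sinh r <= n%:R, n%:R <= 2 * sinh r, n%:R <= expR r & expR r / 4 <= n%:R].
Proof.
move=> r6; have [s1 s2 s3] := sinh_bounds r6.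
have s0 : 0 <= sinh r by lra.
have /andP[t1 t2] := truncn_itv s0.
exists (Num.truncn (sinh r)).+1; move: (Num.truncn _) t1 t2 => k t1 t2.
have kE : k.+1%:R = k%:R + 1 :> R by rewrite natr1.
by rewrite kE in t2 *; split => //; lra.
Qed.

Section Bounds.
Context {d : measure_display} {T : measurableType d} (P : probability T R).
Context (lambda : R) (lambda_gt0 : 0 < lambda) (X : T -> set (R * R)).
Context (poissonX : poisson_process P (@disc R) (line_intensity lambda) X).
Context (r : R) (r6 : 6 <= r).

Let r_gt0 : 0 < r. Proof. by apply: lt_le_trans r6. Qed.
Let p := fine (P [set w | visible_directions (X w) r !=set0]).
Let p_ge0 : 0 <= p. Proof. exact/fine_ge0/measure_ge0. Qed.

(** In the lower bound, [ln 8] comes from [1 + i / 8 >= (i + 1) / 8] and the 4 from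
    [n >= expR r / 4]. In the upper bound the sum is replaced by its first term: that gives two of
    the three [ln 2], the third comes from [r - ln 2], and 16 is eight sectors times the doubling of
    [n]. *)
Lemma visible_prob_supercritical : 2^-1 < lambda ->
  (4 * (expR (2 * lambda * ln 8) * (1 + (2 * lambda - 1)^-1)))^-1 *
    expR (- ((2 * lambda - 1) * r)) <= p /\
  p <= 16 * expR (2 * lambda * (3 * ln 2)) * expR (- ((2 * lambda - 1) * r)).
Proof.
move=> l2; have [n [n0 nT n2T ne n4]] := grid_size r6.
set beta := 2 * lambda; have b1 : 1 < beta by rewrite /beta; lra.
have eE : expR (- ((beta - 1) * r)) = expR r * expR (- (beta * r)).
  by rewrite -expRD; congr expR; ring.
have eb := expR_gt0 (- (beta * r)).
split.
  have := visible_prob_lower lambda_gt0 poissonX r_gt0 n0 n2T; rewrite -/p -/beta.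
  set A := expR (beta * ln 8) * _.
  have A0 : 0 < A by rewrite mulr_gt0 ?expR_gt0 // addr_gt0 // invr_gt0; lra.
  have SA : \sum_(i < n) expR (- (beta * ln (1 + i%:R / 8))) <= A.
    rewrite /A; apply: le_trans (ler_wpM2l (expR_ge0 _) (zeta_sum_le n b1)).
    rewrite mulr_sumr; apply: ler_sum => i _; rewrite -expRD ler_expR.
    have i0 : 0 <= (i : nat)%:R :> R by rewrite ler0n.
    have h : ln i.+1%:R - ln 8 <= ln (1 + i%:R / 8) :> R.
      rewrite -ln_div ?posrE ?ltr0n // ler_ln ?posrE ?divr_gt0 ?ltr0n //; last by lra.
    have h' : beta * (ln i.+1%:R - ln 8) <= beta * ln (1 + i%:R / 8).
      by rewrite ler_pM2l //; lra.
    by lra.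
  move=> /le_trans /(_ (ler_wpM2l p_ge0 SA)) h.
  have A4 : 0 < 4 * A by lra.
  rewrite eE ler_pdivrMl //.
  by have := ler_wpM2r (ltW eb) n4; lra.
have := visible_prob_upper lambda_gt0 poissonX r_gt0 n0 nT; rewrite -/p -/beta.
have S0 : expR (- (beta * (ln 2 + ln 2))) <=
    \sum_(i < n) expR (- (beta * (ln (i%:R + 2) + ln 2))).
  case: (n) n0 => // k _; rewrite big_ord_recl /= add0r lerDl.
  by apply: sumr_ge0 => i _; exact: expR_ge0.
move=> /(le_trans (ler_wpM2l p_ge0 S0)) h.
have e0 := expR_gt0 (- (beta * (ln 2 + ln 2))).
rewrite -(ler_pM2r e0); apply: le_trans h _.
have -> : expR (- (beta * (r - ln 2))) = expR (- (beta * r)) * expR (beta * ln 2).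
  by rewrite -expRD; congr expR; ring.
have -> : 16 * expR (beta * (3 * ln 2)) * expR (- ((beta - 1) * r)) *
    expR (- (beta * (ln 2 + ln 2))) = 16 * (expR r * (expR (- (beta * r)) * expR (beta * ln 2))).
  have -> : expR (beta * (3 * ln 2)) = expR (beta * ln 2) * expR (beta * (ln 2 + ln 2)).
    by rewrite -expRD; congr expR; ring.
  have : expR (beta * (ln 2 + ln 2)) * expR (- (beta * (ln 2 + ln 2))) = 1.
    by rewrite -expRD subrr expR0.
  rewrite eE; move: (expR (beta * (ln 2 + ln 2))) (expR (- (beta * (ln 2 + ln 2)))).
  move=> u v uv; transitivity (16 * (expR r * (expR (- (beta * r)) * expR (beta * ln 2))) * (u * v)).
    by ring.
  by rewrite uv mulr1.
have -> : n.*2%:R = 2 * n%:R :> R by rewrite -mul2n natrM.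
have ee : 0 < expR (- (beta * r)) * expR (beta * ln 2) by rewrite mulr_gt0 ?expR_gt0.
by have := ler_wpM2r (ltW ee) ne; lra.
Qed.

(** Here [n * expR (- r)] lies between [1 / 4] and 1. The first sum is at most
    [8 * (1 + ln n) <= 16 * r], whence 64. The second is at least [(r - ln 4) / 4 >= r / 8], which
    with [ln 4 <= 3] is where [6 <= r] is sharp; against a right side of at most 32 this gives
    256. *)
Lemma visible_prob_critical : lambda = 2^-1 ->
  64^-1 * r^-1 <= p /\ p <= 256 * r^-1.
Proof.
move=> l2; have [n [n0 nT n2T ne n4]] := grid_size r6.
have nR : 0 < n%:R :> R by rewrite ltr0n.
have b1 : 2 * lambda = 1 by rewrite l2; lra.
have er : expR r * expR (- r) = 1 by rewrite -expRD subrr expR0.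
have eN := expR_gt0 (- r).
have n4' : 4^-1 <= n%:R * expR (- r) by have := ler_wpM2r (ltW eN) n4; lra.
have ne' : n%:R * expR (- r) <= 1 by have := ler_wpM2r (ltW eN) ne; lra.
split.
  have := visible_prob_lower lambda_gt0 poissonX r_gt0 n0 n2T; rewrite -/p b1 mul1r.
  have SA : \sum_(i < n) expR (- (1 * ln (1 + i%:R / 8))) <= 16 * r.
    apply: (@le_trans _ _ (8 * \sum_(i < n) (i.+1%:R)^-1)).
      rewrite mulr_sumr; apply: ler_sum => i _; rewrite mul1r.
      have i0 : 0 <= (i : nat)%:R :> R by rewrite ler0n.
      rewrite expRN lnK ?posrE; last by lra.
      rewrite -[8]invrK -invfM lef_pV2 ?posrE; last 2 first.
      - by lra.
      - by rewrite mulr_gt0 // ltr0n.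
      by rewrite -[i.+1%:R]natr1; lra.
    have := @harmonic_le R _ n0.
    have : ln n%:R <= r by rewrite -[leRHS]expRK ler_ln ?posrE ?expR_gt0.
    by have := r6; lra.
  move=> /le_trans /(_ (ler_wpM2l p_ge0 SA)) h.
  rewrite ler_pdivrMr //; lra.
have := visible_prob_upper lambda_gt0 poissonX r_gt0 n0 nT; rewrite -/p b1.
have SB : r / 8 <= \sum_(i < n) expR (- (1 * (ln (i%:R + 2) + ln 2))).
  apply: (@le_trans _ _ (4^-1 * \sum_(i < n) (i.+1%:R)^-1)); last first.
    rewrite mulr_sumr; apply: ler_sum => i _; rewrite mul1r.
    have i0 : 0 <= (i : nat)%:R :> R by rewrite ler0n.
    have i2 : 0 < (i%:R + 2) * 2 :> R by lra.
    have i4 : 0 < 4 * i.+1%:R :> R by rewrite mulr_gt0 // ltr0n.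
    rewrite -lnM ?posrE // expRN lnK ?posrE //.
    rewrite -invfM lef_pV2 ?posrE // -[i.+1%:R]natr1; lra.
  have hn := @harmonic_ge R n.
  have : r - ln 4 <= ln n.+1%:R.
    have -> : r - ln 4 = ln (expR r / 4) by rewrite ln_div ?posrE ?expR_gt0 // expRK.
    rewrite ler_ln ?posrE ?ltr0n ?divr_gt0 ?expR_gt0 // -[n.+1%:R]natr1; lra.
  have : ln 4 <= 3 :> R.
    have -> : 4 = 1 + 3 :> R by lra.
    by apply: le_ln1Dx; lra.
  by have := r6; lra.
move=> /(le_trans (ler_wpM2l p_ge0 SB)).
have -> : expR (- (1 * (r - ln 2))) = expR (- r) * 2.
  by rewrite mul1r opprB addrC expRD lnK ?posrE.
have -> : n.*2%:R = 2 * n%:R :> R by rewrite -mul2n natrM.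
by move=> h; rewrite ler_pdivlMr //; lra.
Qed.

End Bounds.

End Asymptotics.

Theorem theorem6 (R : realType) (lambda : R) (lambda_gt0 : 0 < lambda) :
  exists c c' r0 : R, 0 < c /\ c <= c' /\
    forall (d : measure_display) (T : measurableType d) (P : probability T R)
      (X : T -> set (R * R)),
      poisson_process P disc (line_intensity lambda) X ->
      forall r : R, r0 <= r ->
        let E := [set w | visible_directions (X w) r !=set0] in
        [/\ measurable E,
            2^-1 < lambda ->
              ((c * expR (- ((2 * lambda - 1) * r)))%:E <= P E)%E /\
              (P E <= (c' * expR (- ((2 * lambda - 1) * r)))%:E)%E
          & lambda = 2^-1 ->
              ((c * r^-1)%:E <= P E)%E /\ (P E <= (c' * r^-1)%:E)%E].
Proof.
pose c1 : R := (4 * (expR (2 * lambda * ln 8) * (1 + (2 * lambda - 1)^-1)))^-1.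
pose c1' : R := 16 * expR (2 * lambda * (3 * ln 2)).
(* [c1] is known to be positive only above the critical value, where [2 * lambda - 1 > 0]; hence the
   choice by cases on [lambda]. *)
pose c : R := if 2^-1 < lambda then c1 else 64^-1.
pose c' : R := if 2^-1 < lambda then c1' else 256.
have c0 : 0 < c.
  rewrite /c /c1; case: ifP => // l2.
  rewrite invr_gt0 mulr_gt0 // mulr_gt0 ?expR_gt0 // addr_gt0 // invr_gt0; lra.
have c'0 : 0 < c' by rewrite /c' /c1'; case: ifP => // l2; rewrite mulr_gt0 ?expR_gt0.
(* Taking [c + c'] as upper constant settles the required order without comparing the two. *)
exists c, (c + c'), 6; split => //; split; first by rewrite lerDl ltW.
move=> d T P X poissonX r r6 E.
have mE : measurable E.
  by apply: (measurable_visible_event poissonX); exact: lt_le_trans r6.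
have PE : P E = (fine (P E))%:E by rewrite fineK // fin_num_measure.
have r0 : 0 < r by exact: lt_le_trans r6.
split => // [l2|l2]; rewrite PE !lee_fin.
  have [h1 h2] := visible_prob_supercritical lambda_gt0 poissonX r6 l2.
  rewrite /c /c' l2; split => //; apply: le_trans h2 _.
  rewrite ler_pM2r ?expR_gt0 // lerDr.
  by move: c0; rewrite /c l2 => /ltW.
have [h1 h2] := visible_prob_critical lambda_gt0 poissonX r6 l2.
rewrite /c /c' l2 ltxx; split => //; apply: le_trans h2 _.
by rewrite ler_pM2r ?invr_gt0 // lerDr.
Qed.
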